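(* Let $R$ be a regular (commutative Noetherian) ring of prime characteristic $p$, and let $\mathcal{M}$ be an $F$-finite $F$-module over $R$. Let $n\ge1$ be an integer and let $\mathbf{f}=(f_1,\ldots,f_n)\in R^n$. Then the module of generalized fractions $\mathcal{M}_{\mathbf{f}}:=U_{\mathbf{f}}^{-n}\mathcal{M}$, where $U_{\mathbf{f}}=\{(f_1^{\alpha_1},\ldots,f_n^{\alpha_n}):\alpha_1,\ldots,\alpha_n\ge0\}$, is an $F$-finite $F$-module.
   Context: $F$ denotes the Frobenius functor $R'\otimes_R\bullet$, where $R'$ is $R$ regarded as a left $R$-module naturally and as a right $R$-module via the Frobenius homomorphism $r\mapsto r^p$ (so $r'\otimes rm=r'r^p\otimes m$). An $F$-module is an $R$-module $\mathcal{M}$ equipped with an $R$-isomorphism $\mathcal{M}\to F(\mathcal{M})$, its structure isomorphism. For an $R$-homomorphism $\beta:M\to F(M)$, let $\mathcal{N}$ be the direct limit of $M\xrightarrow{\beta}F(M)\xrightarrow{F(\beta)}F^2(M)\to\cdots$; the maps $F^i(\beta)$ induce an isomorphism $\mathcal{N}\to F(\mathcal{N})$, making $\mathcal{N}$ an $F$-module, and $\beta$ is called a generating morphism for (any $F$-module isomorphic to) $\mathcal{N}$. An $F$-module is $F$-finite if it has a generating morphism $L\to F(L)$ with $L$ a finitely generated $R$-module. Generalized fractions (over a commutative ring $A$): let $D_n(A)$ be the set of lower triangular $n\times n$ matrices over $A$, and $|\mathbf{H}|$ the determinant of $\mathbf{H}$. A triangular subset of $A^n$ is a non-empty $U\subseteq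 A^n$ such that (a) $(u_1,\ldots,u_n)\in U$ implies $(u_1^{\alpha_1},\ldots,u_n^{\alpha_n})\in U$ for all positive integers $\alpha_i$; (b) for all $\mathbf{u},\mathbf{v}\in U$ there are $\mathbf{w}\in U$ and $\mathbf{H},\mathbf{K}\in D_n(A)$ with $\mathbf{H}\mathbf{u}^T=\mathbf{w}^T=\mathbf{K}\mathbf{v}^T$. For an $A$-module $M$, define an equivalence relation on $M\times U$ by $(m,\mathbf{u})\sim(g,\mathbf{v})$ iff there are $\mathbf{w}=(w_1,\ldots,w_n)\in U$ and $\mathbf{H},\mathbf{K}\in D_n(A)$ with $\mathbf{H}\mathbf{u}^T=\mathbf{w}^T=\mathbf{K}\mathbf{v}^T$ and $|\mathbf{H}|m-|\mathbf{K}|g\in\sum_{j=1}^{n-1}w_jM$. The class of $(m,\mathbf{u})$ is written $m/\mathbf{u}$, and $U^{-n}M$ is the set of classes, an $A$-module under $m/\mathbf{u}+g/\mathbf{v}=(|\mathbf{H}|m+|\mathbf{K}|g)/\mathbf{w}$ (for any $\mathbf{w}\in U$, $\mathbf{H},\mathbf{K}\in D_n(A)$ with $\mathbf{H}\mathbf{u}^T=\mathbf{w}^T=\mathbf{K}\mathbf{v}^T$) and $a(m/\mathbf{u})=am/\mathbf{u}$. If $\mathcal{M}$ is an $F$-module with structure isomorphism $\nu$ and $U$ is a triangular subset of $R^n$, then $U^{-n}\mathcal{M}$ is regarded as an $F$-module via the structure isomorphism $\kappa:U^{-n}\mathcal{M}\to F(U^{-n}\mathcal{M})$ determined by $\kappa\bigl(\nu^{-1}(\sum_ir_i'\otimes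 m_i)/(u_1,\ldots,u_n)\bigr)=\sum_iu_1^{p-1}\cdots u_n^{p-1}r_i'\otimes m_i/(u_1,\ldots,u_n)$. *)

(* Defs.v *)
From HB Require Import structures.
From mathcomp Require Import all_boot all_algebra.
From mathcomp Require Import boolp classical_sets.
From mathcomp Require Import ring.

Set Implicit Arguments.
Unset Strict Implicit.
Unset Printing Implicit Defensive.

Import GRing.Theory.

Local Open Scope ring_scope.
Local Open Scope quotient_scope.

(* Regular rings. The structures [idealr] and [prime_idealr] of MathComp are
   proper ideals, given by boolean predicates; classically, any subset of a
   ring is of this form. *)

Definition span_of (A : comNzRingType) (k : nat) (g : 'I_k -> A) (x : A) :=
  exists c : 'I_k -> A, x = \sum_(i < k) c i * g i.

(* The unit ideal is finitely generated, so proper ideals suffice. *)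
Definition noetherian (A : comNzRingType) :=
  forall I : idealr A, exists k (g : 'I_k -> A),
    forall x, x \in I <-> span_of g x.

Definition maximal_ideal (A : comNzRingType) (m : idealr A) :=
  forall J : idealr A, {subset m <= J} -> J =i m.

(* A chain P_0 < P_1 < ... < P_d of prime ideals. *)
Definition prime_chain (A : comNzRingType) (d : nat) :=
  exists P : nat -> prime_idealr A, forall i, (i < d)%N ->
    {subset P i <= P i.+1} /\ exists2 x, x \in P i.+1 & x \notin P i.

Definition krull_dim (A : comNzRingType) (d : nat) :=
  prime_chain A d /\ ~ prime_chain A d.+1.

Definition regular_local (A : comNzRingType) :=
  noetherian A /\
  exists m : idealr A,
    [/\ maximal_ideal m, (forall m' : idealr A, maximal_ideal m' -> m' =i m) &
      exists d (g : 'I_d -> A),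
        krull_dim A d /\ forall x, x \in m <-> span_of g x].

Section Localization.
Variables (R : comNzRingType) (P : prime_idealr R).

Lemma notin_primeM s t : s \notin P -> t \notin P -> s * t \notin P.
Proof. by move=> sP tP; rewrite prime_idealrM negb_or sP tP. Qed.

Lemma notin_prime1 : 1 \notin P.
Proof. by rewrite idealr1. Qed.

Definition loc_pair := (R * {s : R | s \notin P})%type.
HB.instance Definition _ := Choice.on loc_pair.
Implicit Types x y z : loc_pair.

Definition loc_rel x y :=
  exists2 t, t \notin P & t * (x.1 * val y.2 - y.1 * val x.2) = 0.

Definition loc_relb x y := `[< loc_rel x y >].

Lemma loc_rel_equiv : equiv_class_of loc_relb.
Proof.
split=> [x|x y|y x z].
- by apply/asboolP; exists 1; rewrite ?notin_prime1 // subrr mulr0.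
- by apply/asboolP/asboolP => -[t tP e]; exists t => //;
    rewrite -opprB mulrN e oppr0.
- move=> /asboolP [t tP e] /asboolP [t' tP' e']; apply/asboolP.
  exists (t * t' * val y.2).
    by rewrite !notin_primeM // (valP y.2).
  have -> : t * t' * val y.2 * (x.1 * val z.2 - z.1 * val x.2) =
      t' * val z.2 * (t * (x.1 * val y.2 - y.1 * val x.2))
      + t * val x.2 * (t' * (y.1 * val z.2 - z.1 * val y.2)) by ring.
  by rewrite e e' !mulr0 addr0.
Qed.

Canonical loc_equiv := EquivRelPack loc_rel_equiv.

Definition localization := {eq_quot loc_relb}.
HB.instance Definition _ := Choice.on localization.
HB.instance Definition _ := Quotient.on localization.
HB.instance Definition _ : EqQuotient loc_pair loc_relb localization :=
  EqQuotient.on localization.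

Definition loc_class (x : loc_pair) : localization := \pi_localization x.

Definition mk_loc_pair r s (sP : s \notin P) : loc_pair := (r, exist _ s sP).

Definition loc_pair_den_mul x y := notin_primeM (valP x.2) (valP y.2).
Definition loc_pair0 : loc_pair := mk_loc_pair 0 notin_prime1.
Definition loc_pair1 : loc_pair := mk_loc_pair 1 notin_prime1.
Definition loc_pair_opp x : loc_pair := (- x.1, x.2).
Definition loc_pair_add x y : loc_pair :=
  mk_loc_pair (x.1 * val y.2 + y.1 * val x.2) (loc_pair_den_mul x y).
Definition loc_pair_mul x y : loc_pair := mk_loc_pair (x.1 * y.1) (loc_pair_den_mul x y).

Definition loc0 : localization := loc_class loc_pair0.
Definition loc1 : localization := loc_class loc_pair1.
Definition loc_opp (a : localization) : localization := loc_class (loc_pair_opp (repr a)).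
Definition loc_add (a b : localization) : localization :=
  loc_class (loc_pair_add (repr a) (repr b)).
Definition loc_mul (a b : localization) : localization :=
  loc_class (loc_pair_mul (repr a) (repr b)).

Lemma locP x y : loc_rel x y <-> loc_class x = loc_class y.
Proof.
have e := @eqquotP _ loc_relb localization x y.
by split=> [h | /e /asboolP //]; apply/e/asboolP.
Qed.

Lemma loc_repr x : loc_rel (repr (loc_class x)) x.
Proof. by apply/locP; rewrite /loc_class reprK. Qed.

Lemma pi_loc_opp x : loc_opp (loc_class x) = loc_class (loc_pair_opp x).
Proof.
have [t tP e] := loc_repr x; apply/locP; exists t => //=.
by rewrite !mulNr opprK addrC -opprB mulrN e oppr0.
Qed.

Lemma pi_loc_add x y : loc_add (loc_class x) (loc_class y) = loc_class (loc_pair_add x y).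
Proof.
have [t tP e] := loc_repr x; have [s sP e'] := loc_repr y.
apply/locP; exists (t * s) => /=; first exact: notin_primeM.
move: (repr (loc_class x)) (repr (loc_class y)) e e' => x' y' e e'.
have -> : t * s * ((x'.1 * val y'.2 + y'.1 * val x'.2) * (val x.2 * val y.2) -
    (x.1 * val y.2 + y.1 * val x.2) * (val x'.2 * val y'.2)) =
  s * val y.2 * val y'.2 * (t * (x'.1 * val x.2 - x.1 * val x'.2)) +
  t * val x.2 * val x'.2 * (s * (y'.1 * val y.2 - y.1 * val y'.2)) by ring.
by rewrite e e' !mulr0 addr0.
Qed.

Lemma pi_loc_mul x y : loc_mul (loc_class x) (loc_class y) = loc_class (loc_pair_mul x y).
Proof.
have [t tP e] := loc_repr x; have [s sP e'] := loc_repr y.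
apply/locP; exists (t * s) => /=; first exact: notin_primeM.
move: (repr (loc_class x)) (repr (loc_class y)) e e' => x' y' e e'.
have -> : t * s * ((x'.1 * y'.1) * (val x.2 * val y.2) -
    (x.1 * y.1) * (val x'.2 * val y'.2)) =
  s * val y.2 * y'.1 * (t * (x'.1 * val x.2 - x.1 * val x'.2)) +
  t * val x'.2 * x.1 * (s * (y'.1 * val y.2 - y.1 * val y'.2)) by ring.
by rewrite e e' !mulr0 addr0.
Qed.

Lemma loc_rel_eq x y : x.1 * val y.2 = y.1 * val x.2 -> loc_rel x y.
Proof. by move=> e; exists 1; rewrite ?notin_prime1 // e subrr mulr0. Qed.

Lemma loc_ind (Q : localization -> Prop) :
  (forall x, Q (loc_class x)) -> forall a, Q a.
Proof. by move=> h a; rewrite -[a]reprK. Qed.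

Lemma loc_addA : associative loc_add.
Proof.
elim/loc_ind => x; elim/loc_ind => y; elim/loc_ind => z.
by rewrite !pi_loc_add; apply/locP/loc_rel_eq => /=; ring.
Qed.

Lemma loc_addC : commutative loc_add.
Proof.
elim/loc_ind => x; elim/loc_ind => y.
by rewrite !pi_loc_add; apply/locP/loc_rel_eq => /=; ring.
Qed.

Lemma loc_add0 : left_id loc0 loc_add.
Proof.
by elim/loc_ind => x; rewrite pi_loc_add; apply/locP/loc_rel_eq => /=; ring.
Qed.

Lemma loc_addN : left_inverse loc0 loc_opp loc_add.
Proof.
elim/loc_ind => x; rewrite pi_loc_opp pi_loc_add.
by apply/locP/loc_rel_eq => /=; ring.
Qed.

HB.instance Definition _ :=
  GRing.isZmodule.Build localization loc_addA loc_addC loc_add0 loc_addN.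

Lemma loc_mulA : associative loc_mul.
Proof.
elim/loc_ind => x; elim/loc_ind => y; elim/loc_ind => z.
by rewrite !pi_loc_mul; apply/locP/loc_rel_eq => /=; ring.
Qed.

Lemma loc_mulC : commutative loc_mul.
Proof.
elim/loc_ind => x; elim/loc_ind => y.
by rewrite !pi_loc_mul; apply/locP/loc_rel_eq => /=; ring.
Qed.

Lemma loc_mul1 : left_id loc1 loc_mul.
Proof.
by elim/loc_ind => x; rewrite pi_loc_mul; apply/locP/loc_rel_eq => /=; ring.
Qed.

Lemma loc_mulDl : left_distributive loc_mul +%R.
Proof.
elim/loc_ind => x; elim/loc_ind => y; elim/loc_ind => z.
rewrite -[_ + _]/(loc_add _ _) -[RHS]/(loc_add _ _).
by rewrite !(pi_loc_mul, pi_loc_add); apply/locP/loc_rel_eq => /=; ring.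
Qed.

Lemma loc1_neq0 : loc1 != 0.
Proof.
apply/eqP => /locP [t tP] /=; rewrite mul0r subr0 !mulr1 => t0.
by move: tP; rewrite t0 idealr0.
Qed.

HB.instance Definition _ := GRing.Zmodule_isComNzRing.Build localization
  loc_mulA loc_mulC loc_mul1 loc_mulDl loc1_neq0.

End Localization.

Definition regular_ring (R : comNzRingType) :=
  noetherian R /\ forall P : prime_idealr R, regular_local (localization P).

(* An R-module up to an equivalence relation; its quotient is an R-module. *)
Record premodule (R : comNzRingType) := Premodule {
  pm_sort :> choiceType;
  pm_eq : pm_sort -> pm_sort -> Prop;
  pm_zero : pm_sort;
  pm_opp : pm_sort -> pm_sort;
  pm_add : pm_sort -> pm_sort -> pm_sort;
  pm_scale : R -> pm_sort -> pm_sort;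
  pm_refl : forall x, pm_eq x x;
  pm_sym : forall x y, pm_eq x y -> pm_eq y x;
  pm_trans : forall x y z, pm_eq x y -> pm_eq y z -> pm_eq x z;
  pm_oppE : forall x y, pm_eq x y -> pm_eq (pm_opp x) (pm_opp y);
  pm_addE : forall x x' y y', pm_eq x x' -> pm_eq y y' ->
    pm_eq (pm_add x y) (pm_add x' y');
  pm_scaleE : forall a x y, pm_eq x y -> pm_eq (pm_scale a x) (pm_scale a y);
  pm_addA : forall x y z,
    pm_eq (pm_add x (pm_add y z)) (pm_add (pm_add x y) z);
  pm_addC : forall x y, pm_eq (pm_add x y) (pm_add y x);
  pm_add0 : forall x, pm_eq (pm_add pm_zero x) x;
  pm_addN : forall x, pm_eq (pm_add (pm_opp x) x) pm_zero;
  pm_scaleA : forall a b x,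
    pm_eq (pm_scale a (pm_scale b x)) (pm_scale (a * b) x);
  pm_scale1 : forall x, pm_eq (pm_scale 1 x) x;
  pm_scaleDr : forall a x y,
    pm_eq (pm_scale a (pm_add x y)) (pm_add (pm_scale a x) (pm_scale a y));
  pm_scaleDl : forall a b x,
    pm_eq (pm_scale (a + b) x) (pm_add (pm_scale a x) (pm_scale b x))
}.

Section QuotientModule.
Variables (R : comNzRingType) (T : premodule R).

Definition pm_eqb (x y : T) := `[< pm_eq x y >].

Lemma pm_eqb_equiv : equiv_class_of pm_eqb.
Proof.
split=> [x|x y|y x z]; first by apply/asboolP/pm_refl.
  by apply/asboolP/asboolP => /pm_sym.
by move=> /asboolP xy /asboolP yz; apply/asboolP; apply: pm_trans yz.
Qed.

Canonical pm_equiv := EquivRelPack pm_eqb_equiv.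

Definition pm_quot := {eq_quot pm_eqb}.
HB.instance Definition _ := Choice.on pm_quot.
HB.instance Definition _ := Quotient.on pm_quot.
HB.instance Definition _ : EqQuotient T pm_eqb pm_quot := EqQuotient.on pm_quot.

Definition pm_class (x : T) : pm_quot := \pi_pm_quot x.

Lemma pm_classP x y : pm_eq x y <-> pm_class x = pm_class y.
Proof.
have e := @eqquotP _ pm_eqb pm_quot x y.
by split=> [h | /e /asboolP //]; apply/e/asboolP.
Qed.

Lemma pm_repr x : pm_eq (repr (pm_class x)) x.
Proof. by apply/pm_classP; rewrite /pm_class reprK. Qed.

Lemma pm_ind (Q : pm_quot -> Prop) : (forall x, Q (pm_class x)) -> forall a, Q a.
Proof. by move=> h a; rewrite -[a]reprK; apply: h. Qed.

Definition pq_zero : pm_quot := pm_class (pm_zero T).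
Definition pq_opp (a : pm_quot) : pm_quot := pm_class (pm_opp (repr a)).
Definition pq_add (a b : pm_quot) : pm_quot :=
  pm_class (pm_add (repr a) (repr b)).
Definition pq_scale r (a : pm_quot) : pm_quot :=
  pm_class (pm_scale r (repr a)).

Lemma pq_oppE x : pq_opp (pm_class x) = pm_class (pm_opp x).
Proof. by apply/pm_classP/pm_oppE/pm_repr. Qed.

Lemma pq_addE x y : pq_add (pm_class x) (pm_class y) = pm_class (pm_add x y).
Proof. by apply/pm_classP/pm_addE; apply: pm_repr. Qed.

Lemma pq_scaleE r x : pq_scale r (pm_class x) = pm_class (pm_scale r x).
Proof. by apply/pm_classP/pm_scaleE/pm_repr. Qed.

Lemma pq_addA : associative pq_add.
Proof.
elim/pm_ind => x; elim/pm_ind => y; elim/pm_ind => z.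
by rewrite !pq_addE; apply/pm_classP/pm_addA.
Qed.

Lemma pq_addC : commutative pq_add.
Proof.
elim/pm_ind => x; elim/pm_ind => y.
by rewrite !pq_addE; apply/pm_classP/pm_addC.
Qed.

Lemma pq_add0 : left_id pq_zero pq_add.
Proof. by elim/pm_ind => x; rewrite pq_addE; apply/pm_classP/pm_add0. Qed.

Lemma pq_addN : left_inverse pq_zero pq_opp pq_add.
Proof.
by elim/pm_ind => x; rewrite pq_oppE pq_addE; apply/pm_classP/pm_addN.
Qed.

HB.instance Definition _ :=
  GRing.isZmodule.Build pm_quot pq_addA pq_addC pq_add0 pq_addN.

Lemma pq_scaleA a b v : pq_scale a (pq_scale b v) = pq_scale (a * b) v.
Proof.
by elim/pm_ind: v => x; rewrite !pq_scaleE; apply/pm_classP/pm_scaleA.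
Qed.

Lemma pq_scale1 : left_id 1 pq_scale.
Proof. by elim/pm_ind => x; rewrite pq_scaleE; apply/pm_classP/pm_scale1. Qed.

Lemma pq_scaleDr : right_distributive pq_scale +%R.
Proof.
move=> a; elim/pm_ind => x; elim/pm_ind => y.
rewrite -[_ + _]/(pq_add _ _) -[RHS]/(pq_add _ _).
by rewrite !(pq_addE, pq_scaleE); apply/pm_classP/pm_scaleDr.
Qed.

Lemma pq_scaleDl v : {morph pq_scale^~ v : a b / a + b}.
Proof.
move=> a b; elim/pm_ind: v => x; rewrite -[RHS]/(pq_add _ _).
by rewrite !(pq_addE, pq_scaleE); apply/pm_classP/pm_scaleDl.
Qed.

HB.instance Definition _ := GRing.Zmodule_isLmodule.Build R pm_quot
  pq_scaleA pq_scale1 pq_scaleDr pq_scaleDl.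

Lemma pm_classD x y : pm_class x + pm_class y = pm_class (pm_add x y).
Proof. exact: pq_addE. Qed.

Lemma pm_classZ a x : a *: pm_class x = pm_class (pm_scale a x).
Proof. exact: pq_scaleE. Qed.

Lemma pm_class0 : pm_class (pm_zero T) = 0.
Proof. by []. Qed.

Section Lift.
Variables (V : zmodType) (h : T -> V).
Hypothesis hE : forall x y, pm_eq x y -> h x = h y.

Definition pm_lift (a : pm_quot) : V := h (repr a).

Lemma pm_liftE x : pm_lift (pm_class x) = h x.
Proof. exact/hE/pm_repr. Qed.
End Lift.

End QuotientModule.

Definition mklinear (R : comNzRingType) (U V : lmodType R) (h : U -> V)
  (hlin : linear h) : {linear U -> V} :=
  HB.pack h (GRing.isLinear.Build R U V *:%R h hlin).

(* Formal sums of generators, modulo the additive congruence generated by the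
   relations [rel]. By [fsum_ax_D] and [fsum_ax_0], every generator g has the
   inverse [scal (-1) g], so the quotient is the free abelian group on the
   generators modulo the subgroup spanned by the relations. *)
Section FormalSums.
Variables (R : comNzRingType) (G : choiceType) (scal : R -> G -> G).
Variable rel : seq G -> seq G -> Prop.

Inductive fsum_eq : seq G -> seq G -> Prop :=
| fsum_rel s t : rel s t -> fsum_eq s t
| fsum_refl s : fsum_eq s s
| fsum_sym s t : fsum_eq s t -> fsum_eq t s
| fsum_trans s t u : fsum_eq s t -> fsum_eq t u -> fsum_eq s u
| fsum_cat s s' t t' : fsum_eq s s' -> fsum_eq t t' ->
    fsum_eq (s ++ t) (s' ++ t')
| fsum_catC s t : fsum_eq (s ++ t) (t ++ s).

Record fsum_axioms : Prop := FsumAxioms {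
  fsum_ax_rel : forall a s t, rel s t ->
    fsum_eq (map (scal a) s) (map (scal a) t);
  fsum_ax_1 : forall g, scal 1 g = g;
  fsum_ax_M : forall a b g, scal a (scal b g) = scal (a * b) g;
  fsum_ax_D : forall a b g,
    fsum_eq [:: scal (a + b) g] [:: scal a g; scal b g];
  fsum_ax_0 : forall g, fsum_eq [:: scal 0 g] [::]
}.

Variable ax : fsum_axioms.

Lemma fsum_scale a s t : fsum_eq s t ->
  fsum_eq (map (scal a) s) (map (scal a) t).
Proof.
elim=> {s t} [s t /(fsum_ax_rel ax)//|s|s t _ h|s t u _ h _ h'|s s' t t' _ h _ h'|s t].
- exact: fsum_refl.
- exact: fsum_sym.
- exact: fsum_trans h h'.
- by rewrite !map_cat; apply: fsum_cat.
- by rewrite !map_cat; apply: fsum_catC.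
Qed.

Lemma fsum_catACA s t u v :
  fsum_eq ((s ++ t) ++ (u ++ v)) ((s ++ u) ++ (t ++ v)).
Proof.
rewrite -!catA; apply: fsum_cat (fsum_refl _) _; rewrite !catA.
exact: fsum_cat (fsum_catC _ _) (fsum_refl _).
Qed.

Lemma fsum_scaleDl a b s :
  fsum_eq (map (scal (a + b)) s) (map (scal a) s ++ map (scal b) s).
Proof.
elim: s => [|g s IH]; first exact: fsum_refl.
apply: fsum_trans (fsum_cat (fsum_ax_D ax a b g) IH) _.
exact: (fsum_catACA [:: _] [:: _]).
Qed.

Lemma fsum_scale0 s : fsum_eq (map (scal 0) s) [::].
Proof.
elim: s => [|g s IH]; first exact: fsum_refl.
exact: (fsum_cat (fsum_ax_0 ax g) IH).
Qed.

Definition fsum_premodule : premodule R.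
Proof.
refine (@Premodule R (seq G) fsum_eq [::] (map (scal (-1)))
  cat (fun a => map (scal a)) fsum_refl fsum_sym fsum_trans _ fsum_cat
  _ _ _ _ _ _ _ _ _).
- exact: fsum_scale.
- exact: fsum_scale.
- by move=> x y z; rewrite catA; apply: fsum_refl.
- exact: fsum_catC.
- exact: fsum_refl.
- move=> x; rewrite -{2}[x]map_id -(eq_map (fsum_ax_1 ax)).
  apply: fsum_trans (fsum_sym (fsum_scaleDl _ _ _)) _.
  by rewrite addNr; apply: fsum_scale0.
- move=> a b x; rewrite -map_comp (eq_map (fsum_ax_M ax a b)).
  exact: fsum_refl.
- by move=> x; rewrite (eq_map (fsum_ax_1 ax)) map_id; apply: fsum_refl.
- by move=> a x y; rewrite map_cat; apply: fsum_refl.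
- exact: fsum_scaleDl.
Defined.

Definition fsum_module : lmodType R := pm_quot fsum_premodule.

Definition fgen (g : G) : fsum_module := @pm_class _ fsum_premodule [:: g].

Lemma fgenZ a g : a *: fgen g = fgen (scal a g).
Proof. exact: (@pm_classZ _ fsum_premodule). Qed.

Lemma fsum_class (s : seq G) :
  @pm_class _ fsum_premodule s = \sum_(g <- s) fgen g :> fsum_module.
Proof.
elim: s => [|g s IH]; first by rewrite big_nil.
by rewrite big_cons -IH; symmetry; apply: (@pm_classD _ fsum_premodule).
Qed.

Lemma fgen_rel s t : rel s t -> \sum_(g <- s) fgen g = \sum_(g <- t) fgen g.
Proof. by move=> /fsum_rel h; rewrite -!fsum_class; apply/pm_classP. Qed.

Lemma fsum_ind (Q : fsum_module -> Prop) : Q 0 ->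
  (forall g v, Q v -> Q (fgen g + v)) -> forall v, Q v.
Proof.
move=> Q0 QD; apply: pm_ind => s; rewrite fsum_class.
by elim: s => [|g s IH]; rewrite ?big_nil // big_cons; apply: QD.
Qed.

Lemma fsum_linear_ext (V : lmodType R) (h h' : {linear fsum_module -> V}) :
  (forall g, h (fgen g) = h' (fgen g)) -> h =1 h'.
Proof.
move=> e; apply: fsum_ind => [|g v IH]; first by rewrite !linear0.
by rewrite !linearD IH e.
Qed.

Section AdditiveLift.
Variables (V : zmodType) (h : G -> V).
Hypothesis hrel : forall s t, rel s t -> \sum_(g <- s) h g = \sum_(g <- t) h g.

Lemma fsum_lift_eq s t : fsum_eq s t -> \sum_(g <- s) h g = \sum_(g <- t) h g.
Proof.
elim=> {s t} // [s t u _ -> _ -> //|s s' t t' _ e _ e'|s t].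
  by rewrite !big_cat /= e e'.
by rewrite !big_cat /= addrC.
Qed.

Definition fsum_lift_fun : fsum_module -> V :=
  @pm_lift _ fsum_premodule V (fun s : seq G => \sum_(g <- s) h g).

Lemma fsum_lift_fun_class (s : seq G) :
  fsum_lift_fun (@pm_class _ fsum_premodule s) = \sum_(g <- s) h g.
Proof. exact: (@pm_liftE _ fsum_premodule _ _ fsum_lift_eq). Qed.

Lemma fsum_lift_funE g : fsum_lift_fun (fgen g) = h g.
Proof. by rewrite fsum_lift_fun_class big_seq1. Qed.

Lemma fsum_lift_funD : {morph fsum_lift_fun : u v / u + v}.
Proof.
apply: pm_ind => s; apply: pm_ind => t.
by rewrite pm_classD !fsum_lift_fun_class big_cat.
Qed.
End AdditiveLift.

Section Lift.
Variables (V : lmodType R) (h : G -> V).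
Hypothesis hZ : forall a g, h (scal a g) = a *: h g.
Hypothesis hrel : forall s t, rel s t -> \sum_(g <- s) h g = \sum_(g <- t) h g.

Lemma fsum_lift_linear : linear (fsum_lift_fun h).
Proof.
move=> a u v; rewrite fsum_lift_funD //; congr (_ + _).
elim/pm_ind: u => s; rewrite pm_classZ !fsum_lift_fun_class // big_map.
by rewrite scaler_sumr; apply: eq_bigr => g _; rewrite hZ.
Qed.

Definition fsum_lift : {linear fsum_module -> V} := mklinear fsum_lift_linear.

Lemma fsum_liftE g : fsum_lift (fgen g) = h g.
Proof. exact: fsum_lift_funE. Qed.
End Lift.

End FormalSums.

Section Frobenius.
Variables (R : comNzRingType) (p : nat).

Section Object.
Variable M : lmodType R.

Inductive frob_rel : seq (R * M) -> seq (R * M) -> Prop :=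
| frob_rel_Dl r r' m : frob_rel [:: (r + r', m)] [:: (r, m); (r', m)]
| frob_rel_Dr r m m' : frob_rel [:: (r, m + m')] [:: (r, m); (r, m')]
| frob_rel_mid r x m : frob_rel [:: (r * x ^+ p, m)] [:: (r, x *: m)]
| frob_rel_0 m : frob_rel [:: (0, m)] [::].

Definition frob_scal (a : R) (g : R * M) : R * M := (a * g.1, g.2).

Lemma frob_axioms : fsum_axioms frob_scal frob_rel.
Proof.
split=> [a s t h|[r m]|a b [r m]|a b [r m]|[r m]].
- apply: fsum_rel; case: h => [r r' m|r m m'|r x m|m] /=; rewrite /frob_scal /=.
  + by rewrite mulrDr; apply: frob_rel_Dl.
  + exact: frob_rel_Dr.
  + by rewrite mulrA; apply: frob_rel_mid.
  + by rewrite mulr0; apply: frob_rel_0.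
- by rewrite /frob_scal mul1r.
- by rewrite /frob_scal mulrA.
- by rewrite /frob_scal /= mulrDl; apply/fsum_rel/frob_rel_Dl.
- by rewrite /frob_scal /= mul0r; apply/fsum_rel/frob_rel_0.
Qed.

(* F(M) = R' (x)_R M. The relation [frob_rel_mid] is r'x^p (x) m = r' (x) xm,
   and R acts on the left factor. *)
Definition frob : lmodType R := fsum_module frob_axioms.

Definition tens (r : R) (m : M) : frob := fgen frob_axioms (r, m).

Lemma tensZ a r m : a *: tens r m = tens (a * r) m.
Proof. exact: fgenZ. Qed.

Lemma tensDl r r' m : tens (r + r') m = tens r m + tens r' m.
Proof.
have := fgen_rel frob_axioms (frob_rel_Dl r r' m).
by rewrite big_seq1 big_cons big_seq1.
Qed.

Lemma tensDr r m m' : tens r (m + m') = tens r m + tens r m'.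
Proof.
have := fgen_rel frob_axioms (frob_rel_Dr r m m').
by rewrite big_seq1 big_cons big_seq1.
Qed.

Lemma tensr0 r : tens r 0 = 0.
Proof. by apply: (addrI (tens r 0)); rewrite -tensDr !addr0. Qed.

Lemma tens_mid r x m : tens r (x *: m) = tens (r * x ^+ p) m.
Proof.
by have := fgen_rel frob_axioms (frob_rel_mid r x m); rewrite !big_seq1.
Qed.

Lemma tens1 r m : tens r m = r *: tens 1 m.
Proof. by rewrite tensZ mulr1. Qed.

Lemma frob_ind (Q : frob -> Prop) : Q 0 ->
  (forall r m v, Q v -> Q (tens r m + v)) -> forall v, Q v.
Proof. by move=> Q0 QD; apply: fsum_ind => // -[r m]; apply: QD. Qed.

Lemma frob_linear_ext (V : lmodType R) (h h' : {linear frob -> V}) :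
  (forall m, h (tens 1 m) = h' (tens 1 m)) -> h =1 h'.
Proof.
move=> e; apply: fsum_linear_ext => -[r m].
by rewrite -[fgen _ _]/(tens r m) tens1 !linearZ /= e.
Qed.

Section Lift.
Variables (V : lmodType R) (h : M -> V).
Hypothesis hD : {morph h : x y / x + y}.
Hypothesis hZ : forall x m, h (x *: m) = x ^+ p *: h m.

Definition frob_lift_gen (g : R * M) := g.1 *: h g.2.

Lemma frob_lift_scal a g : frob_lift_gen (frob_scal a g) = a *: frob_lift_gen g.
Proof. by rewrite /frob_lift_gen /= scalerA. Qed.

Lemma frob_lift_rel s t : frob_rel s t ->
  \sum_(g <- s) frob_lift_gen g = \sum_(g <- t) frob_lift_gen g.
Proof.
case=> [r r' m|r m m'|r x m|m]; rewrite !(big_cons, big_nil) /frob_lift_gen /= !addr0.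
- by rewrite scalerDl.
- by rewrite hD scalerDr.
- by rewrite hZ scalerA.
- by rewrite scale0r.
Qed.

Definition frob_lift : {linear frob -> V} :=
  fsum_lift frob_axioms frob_lift_scal frob_lift_rel.

Lemma frob_liftE r m : frob_lift (tens r m) = r *: h m.
Proof. exact: fsum_liftE. Qed.
End Lift.

End Object.

Section Map.
Variables (M N : lmodType R) (h : {linear M -> N}).

Lemma frob_map_D : {morph (fun m => tens 1 (h m)) : x y / x + y}.
Proof. by move=> x y; rewrite linearD tensDr. Qed.

Lemma frob_map_Z x m : tens 1 (h (x *: m)) = x ^+ p *: tens 1 (h m).
Proof. by rewrite linearZ tens_mid tensZ mulrC. Qed.

(* F(h) *)
Definition frob_map : {linear frob M -> frob N} :=
  frob_lift frob_map_D frob_map_Z.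

Lemma frob_mapE r m : frob_map (tens r m) = tens r (h m).
Proof. by rewrite frob_liftE tensZ mulr1. Qed.
End Map.

Lemma frob_map_comp (M N P : lmodType R) (h : {linear M -> N})
  (h' : {linear N -> P}) (h'' : {linear M -> P}) :
  (forall m, h'' m = h' (h m)) ->
  forall z, frob_map h'' z = frob_map h' (frob_map h z).
Proof.
move=> e; elim/frob_ind => [|r m v IH]; first by rewrite !linear0.
by rewrite !linearD IH !frob_mapE e.
Qed.

Lemma frob_map_scale (M N : lmodType R) (h h' : {linear M -> N}) (a : R) :
  (forall m, h' m = h (a *: m)) ->
  forall z, frob_map h' z = a ^+ p *: frob_map h z.
Proof.
move=> e; elim/frob_ind => [|r m v IH]; first by rewrite !linear0 ?scaler0.
rewrite [frob_map h' _]linearD [frob_map h _]linearD scalerDr IH !frob_mapE e.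
by rewrite linearZ tens_mid tensZ mulrC.
Qed.

End Frobenius.

Arguments tens {R p M} r m.
Arguments frob_map {R} p {M N} h.
Arguments frob_mapE {R p M N} h r m.

Section DirectLimit.
Variables (R : comNzRingType) (X : nat -> lmodType R).
Variable d : forall i, {linear X i -> X i.+1}.

Definition dl_gen := {i : nat & X i}.
HB.instance Definition _ := Choice.on dl_gen.

Definition dl_in i (x : X i) : dl_gen := Tagged (fun i => X i : Type) x.

(* The limit is the direct sum of the X i modulo x = d x. *)
Inductive dl_rel : seq dl_gen -> seq dl_gen -> Prop :=
| dl_rel_D i (x y : X i) : dl_rel [:: dl_in (x + y)] [:: dl_in x; dl_in y]
| dl_rel_0 i : dl_rel [:: dl_in (0 : X i)] [::]
| dl_rel_step i (x : X i) : dl_rel [:: dl_in x] [:: dl_in (d i x)].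

Definition dl_scal (a : R) (g : dl_gen) : dl_gen := dl_in (a *: tagged g).

Lemma dl_axioms : fsum_axioms dl_scal dl_rel.
Proof.
split=> [a s t h|[i x]|a b [i x]|a b [i x]|[i x]].
- apply: fsum_rel; case: h => [i x y|i|i x] /=; rewrite /dl_scal /=.
  + by rewrite scalerDr; apply: dl_rel_D.
  + by rewrite scaler0; apply: dl_rel_0.
  + by rewrite -linearZ; apply: dl_rel_step.
- by rewrite /dl_scal scale1r.
- by rewrite /dl_scal scalerA.
- by rewrite /dl_scal scalerDl; apply/fsum_rel/dl_rel_D.
- by rewrite /dl_scal scale0r; apply/fsum_rel/dl_rel_0.
Qed.

Definition dirlim : lmodType R := fsum_module dl_axioms.

Section Inclusion.
Variable i : nat.

Definition dl_inj_fun (x : X i) : dirlim := fgen dl_axioms (dl_in x).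

Lemma dl_inj_linear : linear dl_inj_fun.
Proof.
move=> a x y; rewrite /dl_inj_fun.
have := fgen_rel dl_axioms (dl_rel_D (a *: x) y).
by rewrite big_seq1 big_cons big_seq1 => ->; rewrite fgenZ.
Qed.

Definition dl_inj : {linear X i -> dirlim} := mklinear dl_inj_linear.
End Inclusion.

Lemma dl_inj_step i (x : X i) : dl_inj i.+1 (d i x) = dl_inj i x.
Proof.
have := fgen_rel dl_axioms (dl_rel_step x); rewrite !big_seq1 => h.
exact: esym h.
Qed.

Lemma dl_linear_ext (V : lmodType R) (h h' : {linear dirlim -> V}) :
  (forall i (x : X i), h (dl_inj i x) = h' (dl_inj i x)) -> h =1 h'.
Proof. by move=> e; apply: fsum_linear_ext => -[i x]; apply: e. Qed.

Section Lift.
Variables (V : lmodType R) (h : forall i, {linear X i -> V}).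
Hypothesis h_step : forall i (x : X i), h i.+1 (d i x) = h i x.

Definition dl_lift_gen (g : dl_gen) := h (tag g) (tagged g).

Lemma dl_lift_scal a g : dl_lift_gen (dl_scal a g) = a *: dl_lift_gen g.
Proof. by case: g => i x; rewrite /dl_lift_gen /= linearZ. Qed.

Lemma dl_lift_rel s t : dl_rel s t ->
  \sum_(g <- s) dl_lift_gen g = \sum_(g <- t) dl_lift_gen g.
Proof.
case=> [i x y|i|i x]; rewrite !(big_cons, big_nil) /dl_lift_gen /= !addr0.
- by rewrite linearD.
- by rewrite linear0.
- by rewrite h_step.
Qed.

Definition dl_lift : {linear dirlim -> V} :=
  fsum_lift dl_axioms dl_lift_scal dl_lift_rel.

Lemma dl_liftE i (x : X i) : dl_lift (dl_inj i x) = h i x.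
Proof. exact: (fsum_liftE dl_axioms dl_lift_scal dl_lift_rel (dl_in x)). Qed.
End Lift.

End DirectLimit.

Section FModules.
Variables (R : comNzRingType) (p : nat).

Record fmodule := FModule {
  fm_car :> lmodType R;
  fm_str : {linear fm_car -> frob p fm_car};
  fm_bij : bijective fm_str
}.

Definition fmodule_iso (M N : fmodule) :=
  exists2 phi : {linear M -> N}, bijective phi &
    forall x, fm_str N (phi x) = frob_map p phi (fm_str M x).

Section Generate.
Variables (M : lmodType R) (beta : {linear M -> frob p M}).

Fixpoint frob_iter i : lmodType R :=
  if i is i'.+1 then frob p (frob_iter i') else M.

(* F^i(beta) : F^i(M) -> F^(i+1)(M) *)
Fixpoint frob_iter_map i : {linear frob_iter i -> frob_iter i.+1} :=
  match i with
  | 0%N => beta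
  | i'.+1 => frob_map p (frob_iter_map i')
  end.

Definition gen_module : lmodType R := dirlim frob_iter_map.

Local Notation inj := (dl_inj frob_iter_map).

Definition gen_str_at i : {linear frob_iter i -> frob p gen_module} :=
  mklinear (linearP (frob_map p (inj i) \o frob_iter_map i)).

Lemma gen_str_step i (x : frob_iter i) : gen_str_at i.+1 (frob_iter_map i x) = gen_str_at i x.
Proof.
symmetry; apply: frob_map_comp => y.
by rewrite dl_inj_step.
Qed.

Definition gen_str : {linear gen_module -> frob p gen_module} :=
  dl_lift gen_str_step.

Lemma gen_strE i x : gen_str (inj i x) = frob_map p (inj i) (frob_iter_map i x).
Proof. exact: (dl_liftE gen_str_step). Qed.

Lemma gen_strS i (y : frob_iter i.+1) :
  gen_str (inj i.+1 y) = frob_map p (inj i) y.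
Proof.
rewrite gen_strE; symmetry; apply: frob_map_comp => x.
by rewrite dl_inj_step.
Qed.

Section Inverse.
Let hgen (g : dl_gen frob_iter) : gen_module :=
  inj (tag g).+1 (tens 1 (tagged g) : frob_iter (tag g).+1).

Lemma gen_inv_rel s t : dl_rel frob_iter_map s t ->
  \sum_(g <- s) hgen g = \sum_(g <- t) hgen g.
Proof.
case=> [i x y|i|i x]; rewrite !(big_cons, big_nil) !addr0.
- rewrite -[LHS]/(inj i.+1 (tens 1 (x + y) : frob_iter i.+1)) tensDr.
  exact: (linearD (inj i.+1)).
- rewrite -[LHS]/(inj i.+1 (tens 1 0 : frob_iter i.+1)) tensr0.
  exact: (linear0 (inj i.+1)).
- rewrite -[LHS]/(inj i.+1 (tens 1 x : frob_iter i.+1)) -dl_inj_step.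
  by congr (inj i.+2 _); exact: (frob_mapE (frob_iter_map i) 1 x).
Qed.

Let h : gen_module -> gen_module := fsum_lift_fun hgen.

Let h_inj i x : h (inj i x) = inj i.+1 (tens 1 x : frob_iter i.+1).
Proof. exact: (fsum_lift_funE _ gen_inv_rel). Qed.

Let hD : {morph h : x y / x + y}.
Proof.
move=> u v; exact: (fsum_lift_funD gen_inv_rel).
Qed.

Let h0 : h 0 = 0.
Proof. by apply: (addrI (h 0)); rewrite -hD !addr0. Qed.

Let hZ a z : h (a *: z) = a ^+ p *: h z.
Proof.
elim/fsum_ind: z => [|[i x] z IH]; first by rewrite scaler0 h0 scaler0.
rewrite scalerDr !hD scalerDr IH; congr (_ + _).
rewrite -[fgen _ _]/(inj i x) -linearZ !h_inj -linearZ.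
by congr (inj i.+1 _); rewrite /= tens_mid tensZ mulrC.
Qed.

Let inv : {linear frob p gen_module -> gen_module} := frob_lift hD hZ.

Let invE i z : inv (frob_map p (inj i) z) = inj i.+1 z.
Proof.
elim/frob_ind: z => [|r m z IH]; first by rewrite !linear0.
rewrite [frob_map p (inj i) _]linearD [inv _]linearD IH frob_mapE frob_liftE.
by rewrite h_inj -linearZ -linearD; congr (inj i.+1 (_ + _)); rewrite tensZ mulr1.
Qed.

Lemma gen_str_bij : bijective gen_str.
Proof.
exists inv => [z|].
  pose hc : {linear gen_module -> gen_module} := mklinear (linearP (inv \o gen_str)).
  have e : hc =1 idfun.
    apply: dl_linear_ext => i x.
    by rewrite -[LHS]/(inv (gen_str (inj i x))) gen_strE invE dl_inj_step.
  exact: e.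
pose hc : {linear frob p gen_module -> frob p gen_module} :=
  mklinear (linearP (gen_str \o inv)).
suff e : hc =1 idfun by exact: e.
apply: frob_linear_ext => z; rewrite -[LHS]/(gen_str (inv (tens 1 z))).
rewrite frob_liftE scale1r.
elim/fsum_ind: z => [|[i x] z IH].
  by rewrite h0 linear0 [RHS]tensr0.
rewrite hD linearD IH [RHS]tensDr; congr (_ + _).
by rewrite -[fgen _ _]/(inj i x) h_inj gen_strS frob_mapE.
Qed.
End Inverse.

(* The limit of M -> F(M) -> F^2(M) -> ..., with the structure isomorphism
   induced by the maps F^i(beta); see [gen_strE]. *)
Definition gen_fmodule : fmodule := FModule gen_str_bij.

End Generate.

(* beta is a generating morphism for any F-module isomorphic to the limit. *)
Definition generating_morphism (L : lmodType R) (beta : {linear L -> frob p L})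
  (M : fmodule) := fmodule_iso (gen_fmodule beta) M.

Definition fin_generated (L : lmodType R) :=
  exists k (g : 'I_k -> L), forall x, exists c : 'I_k -> R,
    x = \sum_(i < k) c i *: g i.

Definition F_finite (M : fmodule) :=
  exists (L : lmodType R) (beta : {linear L -> frob p L}),
    fin_generated L /\ generating_morphism beta M.

End FModules.

Section TriangularMatrices.
Variables (R : comNzRingType) (n : nat).
Implicit Types (u v w y : 'rV[R]_n) (A B H K P Q : 'M[R]_n).

(* H in D_n(R) and H u^T = w^T; [is_trig_mx] means lower triangular. *)
Definition tri_to H u w := is_trig_mx H /\ H *m u^T = w^T.

Definition powv u k : 'rV[R]_n := \row_i u 0 i ^+ k.

Lemma tri_toE H u w i : tri_to H u w ->
  w 0 i = H i i * u 0 i + \sum_(j < n | (j < i)%N) H i j * u 0 j.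
Proof.
move=> [/is_trig_mxP tH /matrixP/(_ i 0)]; rewrite !mxE => <-.
rewrite (bigD1 i) //= mxE; congr (_ + _).
rewrite (bigID (fun j : 'I_n => (j < i)%N)) /= [X in _ + X]big1 ?addr0.
  apply: eq_big => [j|j _]; last by rewrite mxE.
  by rewrite ltn_neqAle; case: eqVneq => //= ->; rewrite eqxx.
move=> j /andP[ji]; rewrite -leqNgt leq_eqVlt => /predU1P[/val_inj ij|/tH ->].
  by rewrite ij eqxx in ji.
by rewrite mul0r.
Qed.

Lemma tri_to1 u : tri_to 1%:M u u.
Proof. by split; rewrite ?mul1mx ?scalar_mx_is_trig. Qed.

Lemma trig_mul A B : is_trig_mx A -> is_trig_mx B -> is_trig_mx (A *m B).
Proof.
move=> /is_trig_mxP tA /is_trig_mxP tB; apply/is_trig_mxP => i j ij.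
rewrite mxE big1 // => k _; case: (ltnP i k) => [/tA ->|ki]; first by rewrite mul0r.
by rewrite (tB k j (leq_ltn_trans ki ij)) mulr0.
Qed.

Lemma tri_to_comp A B u v w : tri_to A u v -> tri_to B v w -> tri_to (B *m A) u w.
Proof.
by move=> [tA eA] [tB eB]; split; rewrite ?trig_mul // -mulmxA eA.
Qed.

Lemma tri_to_diag u k : tri_to (diag_mx (powv u k)) u (powv u k.+1).
Proof.
split; first exact: diag_mx_is_trig.
apply/matrixP => i j; rewrite ord1 mul_diag_mx !mxE; by rewrite exprSr.
Qed.

Lemma powv1 u : powv u 1 = u.
Proof. by apply/rowP => i; rewrite mxE. Qed.

Lemma tri_to_diag1 u : tri_to (diag_mx u) u (powv u 2).
Proof. by have := tri_to_diag u 1; rewrite powv1. Qed.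

Lemma prod_ltS (F : 'I_n -> R) (o : 'I_n) :
  \prod_(j < n | (j < o.+1)%N) F j = F o * \prod_(j < n | (j < o)%N) F j.
Proof.
rewrite (bigD1 o) //=; congr (_ * _); apply: eq_bigl => j.
by rewrite ltnS [RHS]ltn_neqAle andbC.
Qed.

Section Span.
Variable M : lmodType R.
Implicit Types x m : M.

(* x is in w_1 M + ... + w_k M *)
Definition in_span w k x :=
  exists g : 'I_n -> M, x = \sum_(j < n | (j < k)%N) w 0 j *: g j.

Lemma in_span0 w k : in_span w k 0.
Proof. by exists (fun=> 0); rewrite big1 // => j _; rewrite scaler0. Qed.

Lemma in_spanD w k x m : in_span w k x -> in_span w k m -> in_span w k (x + m).
Proof.
move=> [g ->] [h ->]; exists (fun j => g j + h j).
by rewrite -big_split; apply: eq_bigr => j _; rewrite scalerDr.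
Qed.

Lemma in_spanZ a w k x : in_span w k x -> in_span w k (a *: x).
Proof.
move=> [g ->]; exists (fun j => a *: g j).
by rewrite scaler_sumr; apply: eq_bigr => j _; rewrite !scalerA mulrC.
Qed.

Lemma in_spanN w k x : in_span w k x -> in_span w k (- x).
Proof. by move=> h; rewrite -scaleN1r; apply: in_spanZ. Qed.

Lemma in_span_sum w k (I : finType) (C : pred I) (F : I -> M) :
  (forall i, C i -> in_span w k (F i)) -> in_span w k (\sum_(i | C i) F i).
Proof.
by move=> h; apply: (big_ind (in_span w k)) => //;
  [apply: in_span0 | move=> *; apply: in_spanD].
Qed.

Lemma in_span_gen w k (j : 'I_n) m : (j < k)%N -> in_span w k (w 0 j *: m).
Proof.
move=> jk; exists (fun i => if i == j then m else 0).
rewrite (bigD1 j) //= eqxx big1 ?addr0 // => i /andP[_ /negPf ->].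
by rewrite scaler0.
Qed.

Lemma in_span_le w k l x : (k <= l)%N -> in_span w k x -> in_span w l x.
Proof.
move=> kl [g ->]; apply: in_span_sum => j jk.
exact: in_span_gen (leq_trans jk kl).
Qed.

Lemma tri_cramer A v y m : tri_to A v y -> forall k, (k <= n)%N ->
  forall i : 'I_n, (i < k)%N ->
  in_span y k ((\prod_(j < n | (j < k)%N) A j j * v 0 i) *: m).
Proof.
move=> hA; elim=> [//|k IH kn i]; set o := Ordinal kn.
rewrite (prod_ltS (fun j => A j j) o) ltnS leq_eqVlt => /orP[/eqP io|ik]; last first.
  rewrite -mulrA -scalerA; apply: in_spanZ.
  by apply: in_span_le (leqnSn k) (IH _ _ ik); apply: ltnW.
have -> : i = o by apply: val_inj.
have e : A o o * v 0 o = y 0 o - \sum_(j < n | (j < o)%N) A o j * v 0 j.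
  by rewrite (tri_toE o hA) addrK.
rewrite mulrAC e mulrBl scalerBl; apply: in_spanD.
  by rewrite -scalerA; apply: in_span_gen => /=.
apply: in_spanN; rewrite mulr_suml scaler_suml; apply: in_span_sum => j jk.
rewrite -mulrA [v 0 j * _]mulrC -scalerA; apply: in_spanZ.
by apply: in_span_le (leqnSn k) (IH _ _ jk); apply: ltnW.
Qed.

Lemma tri_det_span A v y k x : tri_to A v y -> (k <= n)%N ->
  in_span v k x -> in_span y k (\det A *: x).
Proof.
move=> hA kn [g ->]; rewrite (det_trig (proj1 hA)).
rewrite (bigID (fun j : 'I_n => (j < k)%N)) /= mulrC -scalerA.
apply: in_spanZ; rewrite scaler_sumr; apply: in_span_sum => j jk.
by rewrite scalerA; apply: (tri_cramer (g j) hA kn jk).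
Qed.

Lemma tri_diag_det y P v : tri_to P v y ->
  \det (diag_mx y *m P) = \prod_(j < n) (y 0 j * P j j).
Proof.
move=> hP; rewrite det_mulmx det_diag (det_trig (proj1 hP)).
by rewrite big_split.
Qed.

Lemma tri_det_uniq P Q v y m : tri_to P v y -> tri_to Q v y ->
  in_span (powv y 2) n.-1
    (\det (diag_mx y *m P) *: m - \det (diag_mx y *m Q) *: m).
Proof.
move=> hP hQ; rewrite !(tri_diag_det hP) (tri_diag_det hQ) -scalerBl.
pose A k := \prod_(j < n | (j < k)%N) (y 0 j * P j j).
pose B k := \prod_(j < n | (j < k)%N) (y 0 j * Q j j).
suff: forall k, (k <= n)%N -> in_span (powv y 2) k.-1 ((A k - B k) *: m).
  have eT (F : 'I_n -> R) : \prod_(j < n | (j < n)%N) F j = \prod_j F j.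
    by apply: eq_bigl => j; rewrite ltn_ord.
  by move=> /(_ n (leqnn n)); rewrite /A /B !eT.
elim=> [|k IH kn]; first by rewrite /A /B !big_pred0 // subrr scale0r => _; apply: in_span0.
set o := Ordinal kn; rewrite /A /B.
rewrite !(prod_ltS (fun j => y 0 j * _ j j) o) -/(A k) -/(B k).
pose c j := P o o * (Q o j - P o j) + (P o o - Q o o) * P o j.
have e : y 0 o * (P o o - Q o o) = \sum_(j < n | (j < o)%N) c j * v 0 j.
  have eP := tri_toE o hP; have eQ := tri_toE o hQ.
  set s := \sum_(j < n | _) P o j * _ in eP.
  set t := \sum_(j < n | _) Q o j * _ in eQ.
  have -> : \sum_(j < n | (j < o)%N) c j * v 0 j =
            P o o * (t - s) + (P o o - Q o o) * s.
    rewrite /s /t -sumrB !mulr_sumr -big_split; apply: eq_bigr => j _ /=.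
    by rewrite /c; ring.
  have st : t - s = (P o o - Q o o) * v 0 o.
    by rewrite mulrBl; apply/eqP; rewrite subr_eq addrAC -eP eQ; apply/eqP; ring.
  by rewrite st eP; ring.
have -> : y 0 o * P o o * A k - y 0 o * Q o o * B k =
  y 0 o * Q o o * (A k - B k) + \sum_(j < n | (j < o)%N) c j * (A k * v 0 j).
  have -> : \sum_(j < n | (j < o)%N) c j * (A k * v 0 j) =
            A k * (y 0 o * (P o o - Q o o)).
    by rewrite e mulr_sumr; apply: eq_bigr => j _; ring.
  ring.
rewrite scalerDl; apply: in_spanD.
  rewrite -scalerA; apply: in_spanZ; apply: in_span_le (leq_pred k) (IH _).
  exact: ltnW.
rewrite scaler_suml; apply: in_span_sum => j jk; rewrite -scalerA.
apply: in_spanZ.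
have := tri_cramer m (tri_to_comp hP (tri_to_diag1 y)) (ltnW kn) jk.
congr (in_span _ _ ((_ * _) *: m)); apply: eq_bigr => i _.
by rewrite mul_diag_mx mxE.
Qed.

End Span.
End TriangularMatrices.

Record triangular (R : comNzRingType) (n : nat) (U : set 'rV[R]_n) : Prop := {
  tri_nonempty : exists u, U u;
  tri_pow : forall u (a : 'I_n -> nat), U u -> (forall i, (0 < a i)%N) ->
    U (\row_i u 0 i ^+ a i);
  tri_common : forall u v, U u -> U v ->
    exists w H K, [/\ U w, tri_to H u w & tri_to K v w]
}.

Section GeneralizedFractions.
Variables (R : comNzRingType) (n : nat) (M : lmodType R).
Variables (U : set 'rV[R]_n) (tU : triangular U).

Definition gf_pair := (M * U)%type.
HB.instance Definition _ := Choice.on gf_pair.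

(* w_1 M + ... + w_(n-1) M is [in_span w n.-1] *)
Definition gf_eq (x y : gf_pair) :=
  exists w H K, [/\ U w, tri_to H (val x.2) w, tri_to K (val y.2) w &
    in_span w n.-1 (\det H *: x.1 - \det K *: y.1)].

Lemma denP (u : U) : U (val u).
Proof. exact: set_mem (valP u). Qed.

Definition den u (Uu : U u) : U := exist _ u (mem_set Uu).

Lemma tri_sq y : U y -> U (powv y 2).
Proof. by move=> Uy; apply: (tri_pow tU (a := fun=> 2%N)). Qed.

(* m / y = 0 *)
Definition gf_null (y : 'rV[R]_n) (m : M) :=
  exists C z, [/\ U z, tri_to C y z & in_span z n.-1 (\det C *: m)].

Lemma gf_null_add y m m' : gf_null y m -> gf_null y m' -> gf_null y (m + m').
Proof.
move=> [C [z [Uz hC sC]]] [C' [z' [Uz' hC' sC']]].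
have [t [A [B [Ut hA hB]]]] := tri_common tU Uz Uz'.
have hAC := tri_to_comp hC hA; have hBC := tri_to_comp hC' hB.
exists (diag_mx t *m (A *m C)), (powv t 2); split.
- exact: tri_sq.
- exact: tri_to_comp hAC (tri_to_diag1 t).
rewrite scalerDr -[X in _ + X](subrK (\det (diag_mx t *m (B *m C')) *: m')).
apply: in_spanD; last apply: in_spanD.
- rewrite mulmxA det_mulmx -scalerA.
  apply: tri_det_span (tri_to_comp hA (tri_to_diag1 t)) (leq_pred n) _.
  exact: sC.
- exact: (tri_det_uniq m' hAC hBC).
- rewrite mulmxA det_mulmx -scalerA.
  apply: tri_det_span (tri_to_comp hB (tri_to_diag1 t)) (leq_pred n) _.
  exact: sC'.
Qed.

Lemma gf_null_uniq P Q u y m : U y -> tri_to P u y -> tri_to Q u y ->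
  gf_null y (\det P *: m - \det Q *: m).
Proof.
move=> Uy hP hQ; exists (diag_mx y), (powv y 2); split.
- exact: tri_sq.
- exact: tri_to_diag1.
by have := tri_det_uniq m hP hQ; rewrite !det_mulmx -!scalerA -scalerBr.
Qed.

Lemma gf_null_raise A w y m : U y -> tri_to A w y -> in_span w n.-1 m ->
  gf_null y (\det A *: m).
Proof.
move=> Uy hA sm; exists 1%:M, y; split=> //; first exact: tri_to1.
by rewrite det1 scale1r; apply: tri_det_span hA (leq_pred n) sm.
Qed.

Lemma gf_null_lower A w y m : tri_to A w y -> gf_null y (\det A *: m) -> gf_null w m.
Proof.
move=> hA [C [z [Uz hC s]]]; exists (C *m A), z; split=> //.
  exact: tri_to_comp hA hC.
by rewrite det_mulmx -scalerA.
Qed.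

Lemma gf_null_eq P Q y x x' : tri_to P (val x.2) y -> tri_to Q (val x'.2) y ->
  gf_null y (\det P *: x.1 - \det Q *: x'.1) -> gf_eq x x'.
Proof.
move=> hP hQ [C [z [Uz hC s]]]; exists z, (C *m P), (C *m Q); split=> //.
- exact: tri_to_comp hP hC.
- exact: tri_to_comp hQ hC.
by rewrite !det_mulmx -!scalerA -scalerBr.
Qed.

Lemma gf_eq_null P Q y x x' : U y -> tri_to P (val x.2) y -> tri_to Q (val x'.2) y ->
  gf_eq x x' -> gf_null y (\det P *: x.1 - \det Q *: x'.1).
Proof.
move=> Uy hP hQ [w [H [K [Uw hH hK s]]]].
have [t [A [B [Ut hA hB]]]] := tri_common tU Uw Uy.
apply: (gf_null_lower hB).
have -> : \det B *: (\det P *: x.1 - \det Q *: x'.1) =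
  (\det (B *m P) *: x.1 - \det (A *m H) *: x.1) +
  (\det A *: (\det H *: x.1 - \det K *: x'.1) +
  (\det (A *m K) *: x'.1 - \det (B *m Q) *: x'.1)).
  rewrite !det_mulmx !scalerBr !scalerA addrA subrKA addrA.
  by rewrite -[in RHS]addrA subrKA.
apply: gf_null_add; last apply: gf_null_add.
- exact: gf_null_uniq (tri_to_comp hP hB) (tri_to_comp hH hA).
- exact: gf_null_raise s.
- exact: gf_null_uniq (tri_to_comp hK hA) (tri_to_comp hQ hB).
Qed.

Lemma gf_refl x : gf_eq x x.
Proof.
exists (val x.2), 1%:M, 1%:M; split; try exact: tri_to1.
  exact: denP.
by rewrite subrr; apply: in_span0.
Qed.

Lemma gf_sym x y : gf_eq x y -> gf_eq y x.
Proof.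
move=> [w [H [K [Uw hH hK s]]]]; exists w, K, H; split=> //.
by rewrite -opprB; apply: in_spanN.
Qed.

Lemma gf_common3 (u v w : U) : exists y A B C,
  [/\ U y, tri_to A (val u) y, tri_to B (val v) y & tri_to C (val w) y].
Proof.
have [s [H [K [Us hH hK]]]] := tri_common tU (denP u) (denP v).
have [t [A [B [Ut hA hB]]]] := tri_common tU Us (denP w).
by exists t, (A *m H), (A *m K), B; split=> //; apply: tri_to_comp hA.
Qed.

Lemma gf_trans x y z : gf_eq x y -> gf_eq y z -> gf_eq x z.
Proof.
move=> xy yz; have [t [A [B [C [Ut hA hB hC]]]]] := gf_common3 x.2 y.2 z.2.
apply: (gf_null_eq hA hC); rewrite -(subrKA (\det B *: y.1)).
by apply: gf_null_add; apply: gf_eq_null.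
Qed.

Lemma gf_raise (u w : U) H m : tri_to H (val u) (val w) ->
  gf_eq (m, u) (\det H *: m, w).
Proof.
move=> hH; exists (val w), H, 1%:M; split=> //; try exact: tri_to1.
  exact: denP.
by rewrite det1 scale1r subrr; apply: in_span0.
Qed.

Lemma gf_common (x y : gf_pair) : exists t : 'rV[R]_n * 'M[R]_n * 'M[R]_n,
  [/\ U t.1.1, tri_to t.1.2 (val x.2) t.1.1 & tri_to t.2 (val y.2) t.1.1].
Proof.
have [w [H [K h]]] := tri_common tU (denP x.2) (denP y.2).
by exists (w, H, K).
Qed.

(* m/u + g/v = (|H|m + |K|g)/w for a choice of w, H and K; see [gf_addE]. *)
Definition gf_add (x y : gf_pair) : gf_pair :=
  let: exist (w, H, K) h := cid (gf_common x y) in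
  (\det H *: x.1 + \det K *: y.1, den (let: And3 Uw _ _ := h in Uw)).

Lemma gf_addE (x y : gf_pair) w H K (Uw : U w) :
  tri_to H (val x.2) w -> tri_to K (val y.2) w ->
  gf_eq (gf_add x y) (\det H *: x.1 + \det K *: y.1, den Uw).
Proof.
rewrite /gf_add; case: cid => -[[w' H'] K'] [/= Uw' hH' hK'] hH hK.
have [t [A [B [Ut hA hB]]]] := tri_common tU Uw' Uw.
apply: (gf_null_eq (y := t) (P := A) (Q := B)) => //=.
have -> : \det A *: (\det H' *: x.1 + \det K' *: y.1) -
          \det B *: (\det H *: x.1 + \det K *: y.1) =
  (\det (A *m H') *: x.1 - \det (B *m H) *: x.1) +
  (\det (A *m K') *: y.1 - \det (B *m K) *: y.1).
  by rewrite !det_mulmx !scalerDr !scalerA opprD addrACA.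
apply: gf_null_add.
- exact: gf_null_uniq (tri_to_comp hH' hA) (tri_to_comp hH hB).
- exact: gf_null_uniq (tri_to_comp hK' hA) (tri_to_comp hK hB).
Qed.

Lemma gf_add_same (u : U) m g : gf_eq (gf_add (m, u) (g, u)) (m + g, u).
Proof.
have := @gf_addE (m, u) (g, u) _ _ _ (denP u) (tri_to1 _) (tri_to1 _).
rewrite /= det1 !scale1r; have -> // : den (denP u) = u by apply: val_inj.
Qed.

Lemma gf_eq_same (u : U) m g : gf_null (val u) (m - g) -> gf_eq (m, u) (g, u).
Proof.
move=> h; apply: (@gf_null_eq 1%:M 1%:M (val u) (m, u) (g, u)); try exact: tri_to1.
by rewrite det1 !scale1r.
Qed.

Lemma gf_same_null (u : U) m g : gf_eq (m, u) (g, u) -> gf_null (val u) (m - g).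
Proof.
move=> /(@gf_eq_null 1%:M 1%:M _ (m, u) (g, u) (denP u) (tri_to1 _) (tri_to1 _)).
by rewrite det1 !scale1r.
Qed.

Lemma gf_to_common3 x y z : exists (u : U) a b c,
  [/\ gf_eq x (a, u), gf_eq y (b, u) & gf_eq z (c, u)].
Proof.
have [t [A [B [C [Ut hA hB hC]]]]] := gf_common3 x.2 y.2 z.2.
exists (den Ut), (\det A *: x.1), (\det B *: y.1), (\det C *: z.1).
by case: x y z hA hB hC => [? ?] [? ?] [? ?] /= hA hB hC; split; apply: gf_raise.
Qed.

Lemma gf_add_common x y (u : U) a b : gf_eq x (a, u) -> gf_eq y (b, u) ->
  gf_eq (gf_add x y) (a + b, u).
Proof.
move=> xa yb.
have [t [A [B [C [Ut hA hB hC]]]]] := gf_common3 x.2 y.2 u.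
apply: (gf_trans (gf_addE Ut hA hB)).
apply: (@gf_null_eq 1%:M C t _ (a + b, u)) => //=; first exact: tri_to1.
rewrite det1 scale1r scalerDr opprD addrACA.
by apply: gf_null_add; [apply: (@gf_eq_null A C t x (a, u)) | apply: (@gf_eq_null B C t y (b, u))].
Qed.

Lemma gf_addP x x' y y' : gf_eq x x' -> gf_eq y y' ->
  gf_eq (gf_add x y) (gf_add x' y').
Proof.
move=> xx yy; have [u [a [b [_ [xa yb _]]]]] := gf_to_common3 x y x.
apply: (gf_trans (gf_add_common xa yb)); apply: gf_sym.
by apply: gf_add_common; [apply: gf_trans xa | apply: gf_trans yb];
  apply: gf_sym.
Qed.

Definition gf_zero : gf_pair := (0, den (projT2 (cid (tri_nonempty tU)))).
Definition gf_scale (a : R) (x : gf_pair) : gf_pair := (a *: x.1, x.2).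
Definition gf_opp (x : gf_pair) : gf_pair := (- x.1, x.2).

Lemma gf_scaleP a x y : gf_eq x y -> gf_eq (gf_scale a x) (gf_scale a y).
Proof.
move=> [w [H [K [Uw hH hK s]]]]; exists w, H, K; split=> //=.
rewrite !scalerA ![\det _ * a]mulrC -!scalerA -scalerBr.
exact: in_spanZ.
Qed.

Lemma gf_oppP x y : gf_eq x y -> gf_eq (gf_opp x) (gf_opp y).
Proof.
by move=> /(gf_scaleP (-1)); rewrite /gf_scale !scaleN1r.
Qed.

Lemma gf_zeroE (u : U) : gf_eq gf_zero (0, u).
Proof.
have [w [H [K [Uw hH hK]]]] := tri_common tU (denP gf_zero.2) (denP u).
exists w, H, K; split=> //=; rewrite !scaler0 subrr; exact: in_span0.
Qed.

Definition gf_premodule : premodule R.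
Proof.
refine (@Premodule R gf_pair gf_eq gf_zero gf_opp gf_add gf_scale
  gf_refl gf_sym gf_trans gf_oppP gf_addP gf_scaleP _ _ _ _ _ _ _ _).
- move=> x y z; have [u [a [b [c [xa yb zc]]]]] := gf_to_common3 x y z.
  apply: (gf_trans (gf_add_common xa (gf_add_common yb zc))).
  rewrite addrA; apply: gf_sym.
  exact: gf_add_common (gf_add_common xa yb) zc.
- move=> x y; have [u [a [b [_ [xa yb _]]]]] := gf_to_common3 x y x.
  apply: (gf_trans (gf_add_common xa yb)); apply: gf_sym; rewrite addrC.
  exact: gf_add_common.
- move=> [m u]; apply: (gf_trans (gf_add_common (gf_zeroE u) (gf_refl _))).
  by rewrite add0r; apply: gf_refl.
- move=> [m u].
  apply: (gf_trans (gf_add_same u (- m) m)); rewrite addNr.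
  exact/gf_sym/gf_zeroE.
- by move=> a b x; rewrite /gf_scale scalerA; apply: gf_refl.
- by move=> [m u]; rewrite /gf_scale scale1r; apply: gf_refl.
- move=> a x y; have [u [c [d [_ [xa yb _]]]]] := gf_to_common3 x y x.
  apply: (gf_trans (gf_scaleP a (gf_add_common xa yb))).
  rewrite /gf_scale /= scalerDr; apply: gf_sym.
  exact: gf_add_common (gf_scaleP a xa) (gf_scaleP a yb).
- move=> a b [m u]; rewrite /gf_scale /= scalerDl.
  exact/gf_sym/gf_add_same.
Defined.

(* U^(-n) M *)
Definition genfrac : lmodType R := pm_quot gf_premodule.

(* m / u *)
Definition mkgf (m : M) (u : U) : genfrac := @pm_class _ gf_premodule (m, u).

Lemma mkgfP m u g v : mkgf m u = mkgf g v <-> gf_eq (m, u) (g, v).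
Proof. by split => /(@pm_classP _ gf_premodule). Qed.

Lemma mkgf_ind (Q : genfrac -> Prop) : (forall m u, Q (mkgf m u)) ->
  forall a, Q a.
Proof. by move=> h; apply: pm_ind => -[m u]; apply: h. Qed.

Lemma mkgfD m u g v (w : U) H K :
  tri_to H (val u) (val w) -> tri_to K (val v) (val w) ->
  mkgf m u + mkgf g v = mkgf (\det H *: m + \det K *: g) w.
Proof.
move=> hH hK; rewrite /mkgf (@pm_classD _ gf_premodule).
apply/pm_classP; apply: (gf_trans (gf_addE (x:=(m,u)) (y:=(g,v)) (denP w) hH hK)).
have -> : den (denP w) = w by apply: val_inj.
exact: gf_refl.
Qed.

Lemma mkgfZ a m u : a *: mkgf m u = mkgf (a *: m) u.
Proof. exact: (@pm_classZ _ gf_premodule). Qed.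

Lemma mkgf_linear u : linear (mkgf ^~ u).
Proof.
move=> a m g; rewrite mkgfZ (mkgfD _ _ (tri_to1 _) (tri_to1 _)).
by rewrite det1 !scale1r.
Qed.

Definition gf_over u : {linear M -> genfrac} := mklinear (mkgf_linear u).

Lemma gf_overE u m : gf_over u m = mkgf m u.
Proof. by []. Qed.

Lemma mkgf_raise m (u w : U) H : tri_to H (val u) (val w) ->
  mkgf (\det H *: m) w = mkgf m u.
Proof. by move=> hH; apply/mkgfP/gf_sym/gf_raise. Qed.

Lemma mkgf_kill m (w : U) (j : 'I_n) : (j < n.-1)%N ->
  mkgf (val w 0 j *: m) w = 0.
Proof.
move=> jn; rewrite -[RHS](linear0 (gf_over w)); apply/mkgfP.
exists (val w), 1%:M, 1%:M; split; try exact: tri_to1.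
  exact: denP.
by rewrite det1 !scale1r subr0; apply: in_span_gen.
Qed.

Section Lift.
Variables (V : zmodType) (phi : U -> M -> V).
Hypothesis phiD : forall u, {morph phi u : m g / m + g}.
Hypothesis phi_raise : forall (u w : U) H m, tri_to H (val u) (val w) ->
  phi w (\det H *: m) = phi u m.
Hypothesis phi_kill : forall (w : U) (j : 'I_n) m, (j < n.-1)%N ->
  phi w (val w 0 j *: m) = 0.

Lemma gf_phi0 u : phi u 0 = 0.
Proof. by apply: (addrI (phi u 0)); rewrite -phiD !addr0. Qed.

Definition gf_lift_pair (x : gf_pair) := phi x.2 x.1.

Lemma gf_lift_pair_eq x y : gf_eq x y -> gf_lift_pair x = gf_lift_pair y.
Proof.
move=> [w [H [K [Uw hH hK [g e]]]]]; rewrite /gf_lift_pair.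
rewrite -(phi_raise (w := den Uw) _ hH) -(phi_raise (w := den Uw) _ hK).
rewrite -[\det H *: _](subrK (\det K *: y.1)) e phiD -[RHS]add0r.
congr (_ + _); elim/big_ind: _ => [|m m' h h'|j jn].
- exact: gf_phi0.
- by rewrite phiD h h' addr0.
- exact: (phi_kill (den Uw)).
Qed.

Definition gf_lift : genfrac -> V := @pm_lift _ gf_premodule _ gf_lift_pair.

Lemma gf_liftE m u : gf_lift (mkgf m u) = phi u m.
Proof. exact: (@pm_liftE _ gf_premodule _ _ gf_lift_pair_eq). Qed.

Lemma gf_liftD : {morph gf_lift : a b / a + b}.
Proof.
elim/mkgf_ind => m u; elim/mkgf_ind => g v.
have [w [H [K [Uw hH hK]]]] := tri_common tU (denP u) (denP v).
rewrite (@mkgfD _ _ _ _ (den Uw) _ _ hH hK) !gf_liftE phiD.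
by rewrite (phi_raise (w := den Uw) _ hH) (phi_raise (w := den Uw) _ hK).
Qed.
End Lift.

End GeneralizedFractions.

Arguments gf_over {R n} M {U} tU u.
Arguments mkgf {R n M U} tU m u.

Section GenfracFModule.
Variables (R : comNzRingType) (p : nat) (charRp : p \in [pchar R]).
Variables (M : fmodule R p) (n : nat) (U : set 'rV[R]_n) (tU : triangular U).

Local Notation nu := (fm_str M).
Local Notation "m // u" := (mkgf tU m u) (at level 40).
Local Notation over := (gf_over M tU).
Local Notation N := (genfrac M tU).

Lemma char_gt0 : (0 < p)%N.
Proof. exact/prime_gt0/(pcharf_prime charRp). Qed.

Lemma char_predn : p = p.-1.+1.
Proof. by rewrite prednK ?char_gt0. Qed.

Lemma tri_to_frob (u w : 'rV[R]_n) (H : 'M[R]_n) : tri_to H u w ->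
  tri_to (map_mx (pFrobenius_aut charRp) H) (powv u p) (powv w p).
Proof.
move=> [/is_trig_mxP tH eH].
have powE (v : 'rV[R]_n) : powv v p = map_mx (pFrobenius_aut charRp) v.
  by apply/rowP => i; rewrite !mxE pFrobenius_autE.
split.
  by apply/is_trig_mxP => i j ij; rewrite mxE tH // rmorph0.
by rewrite !powE !matrix.map_trmx -map_mxM eH.
Qed.

Lemma tri_pown (u : 'rV[R]_n) k : (0 < k)%N -> U u -> U (powv u k).
Proof. by move=> k0 Uu; apply: (tri_pow tU (a := fun=> k)). Qed.

Definition den_pow (u : U) k (k0 : (0 < k)%N) : U := den (tri_pown k0 (denP u)).

Lemma det_diag_powv (u : 'rV[R]_n) k :
  \det (diag_mx (powv u k)) = \prod_i u 0 i ^+ k.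
Proof. by rewrite det_diag; apply: eq_bigr => i _; rewrite mxE. Qed.

(* F(m |-> m/u) kills u_j^p F(M) for j < n *)
Lemma frob_over_kill (w : U) (j : 'I_n) z : (j < n.-1)%N ->
  val w 0 j ^+ p *: frob_map p (over w) z = 0.
Proof.
move=> jn; elim/frob_ind: z => [|r m z IH].
  by rewrite linear0 scaler0.
rewrite linearD scalerDr IH addr0 frob_mapE tensZ mulrC -tens_mid.
by rewrite gf_overE mkgfZ mkgf_kill // tensr0.
Qed.

Lemma frob_over_raise (u w : U) H z : tri_to H (val u) (val w) ->
  frob_map p (over u) z = \det H ^+ p *: frob_map p (over w) z.
Proof.
move=> hH; apply: frob_map_scale => m.
by rewrite !gf_overE (mkgf_raise tU m hH).
Qed.

(* kappa (m / u) is u_1^(p-1) ... u_n^(p-1) F(. / u)(nu m), where F(. / u) sends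
   r (x) g to r (x) (g / u). The usual formula is [kappaE]. *)
Definition kappa_num (u : U) (m : M) : frob p N :=
  (\prod_i val u 0 i ^+ p.-1) *: frob_map p (over u) (nu m).

Lemma kappa_numD u : {morph kappa_num u : m g / m + g}.
Proof. by move=> m g; rewrite /kappa_num [nu _]linearD [frob_map _ _ _]linearD scalerDr. Qed.

Lemma kappa_num_raise (u w : U) H m : tri_to H (val u) (val w) ->
  kappa_num w (\det H *: m) = kappa_num u m.
Proof.
move=> hH; rewrite /kappa_num [nu _]linearZ [frob_map p _ _]linearZ.
rewrite (frob_over_raise _ hH) !scalerA; move: (nu m) => z.
pose w2 := den_pow w (isT : (0 < 2)%N).
pose W := powv (val w) p.
pose P := diag_mx (powv (val w) p.-1) *m H.
pose Q := map_mx (pFrobenius_aut charRp) H *m diag_mx (powv (val u) p.-1).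
have hP : tri_to P (val u) W.
  by apply: tri_to_comp hH _; rewrite /W [in powv _ p]char_predn; apply: tri_to_diag.
have hQ : tri_to Q (val u) W.
  apply: tri_to_comp (tri_to_frob hH); rewrite [in powv _ p]char_predn.
  exact: tri_to_diag.
have dP : \det P = \prod_i val w 0 i ^+ p.-1 * \det H.
  by rewrite det_mulmx det_diag_powv.
have dQ : \det Q = \prod_i val u 0 i ^+ p.-1 * \det H ^+ p.
  rewrite det_mulmx det_diag_powv mulrC; congr (_ * _).
  exact: (det_map_mx (pFrobenius_aut charRp)).
rewrite -dP -dQ.
have hS : tri_to (diag_mx (val w)) (val w) (val w2) by apply: tri_to_diag1.
rewrite (frob_over_raise _ hS) !scalerA.
have -> : \det (diag_mx (val w)) ^+ p = \det (diag_mx W).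
  by rewrite det_diag_powv det_diag prodrXl.
apply/eqP; rewrite -subr_eq0 -scalerBl; apply/eqP.
have -> : \det P * \det (diag_mx W) - \det Q * \det (diag_mx W) =
   \det (diag_mx W *m P) - \det (diag_mx W *m Q).
  by rewrite !det_mulmx; ring.
rewrite -linearZ scalerBl.
have [g ->] := tri_det_uniq z hP hQ.
rewrite linear_sum big1 // => j jn.
rewrite -[LHS]/(frob_map p (over w2) (powv W 2 0 j *: g j)) linearZ.
have -> : powv W 2 0 j = val w2 0 j ^+ p by rewrite !mxE -!exprM mulnC.
exact: frob_over_kill.
Qed.

Lemma kappa_num_kill (w : U) (j : 'I_n) m : (j < n.-1)%N ->
  kappa_num w (val w 0 j *: m) = 0.
Proof.
move=> jn; rewrite /kappa_num [nu _]linearZ [frob_map p _ _]linearZ scalerA.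
rewrite (bigD1 j) //= mulrAC -exprSr prednK ?char_gt0 // mulrC -scalerA.
by rewrite frob_over_kill // scaler0.
Qed.

Definition kappa_fun : N -> frob p N := gf_lift (tU := tU) kappa_num.

Lemma kappa_funE m u : kappa_fun (m // u) = kappa_num u m.
Proof. exact: gf_liftE kappa_numD kappa_num_raise kappa_num_kill _ _. Qed.

Lemma kappa_linear : linear kappa_fun.
Proof.
move=> a; elim/mkgf_ind => m u v.
rewrite [LHS](gf_liftD kappa_numD kappa_num_raise kappa_num_kill).
congr (_ + _); rewrite -/kappa_fun; rewrite mkgfZ !kappa_funE /kappa_num.
by rewrite [nu _]linearZ [frob_map p _ _]linearZ !scalerA mulrC.
Qed.

Definition kappa : {linear N -> frob p N} := mklinear kappa_linear.

Lemma kappaE k (r : 'I_k -> R) (m_ : 'I_k -> M) (m : M) (u : U) :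
  nu m = \sum_(i < k) tens (r i) (m_ i) ->
  kappa (m // u) =
    \sum_(i < k) tens ((\prod_(j < n) val u 0 j ^+ p.-1) * r i) (m_ i // u).
Proof.
move=> e; rewrite -[LHS]/(kappa_fun _) kappa_funE /kappa_num e.
rewrite [frob_map _ _ _]linear_sum scaler_sumr; apply: eq_bigr => i _.
by rewrite -tensZ; congr (_ *: _); apply: frob_mapE.
Qed.

Section Inverse.
Variable inu : frob p M -> M.
Hypotheses (nuK : cancel nu inu) (inuK : cancel inu nu).

Let inuD : {morph inu : x y / x + y}.
Proof. by move=> x y; apply: (can_inj nuK); rewrite linearD !inuK. Qed.

Let inuZ a x : inu (a *: x) = a *: inu x.
Proof. by apply: (can_inj nuK); rewrite linearZ /= !inuK. Qed.

Let phi (u : U) (m : M) : N := inu (tens 1 m) // den_pow u char_gt0.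

Let phiD u : {morph phi u : m g / m + g}.
Proof. by move=> m g; rewrite /phi tensDr inuD -!gf_overE linearD. Qed.

Let phiZ u a m : phi u (a *: m) = a ^+ p *: phi u m.
Proof. by rewrite /phi tens_mid mul1r tens1 inuZ -mkgfZ. Qed.

Let phi_raise (u w : U) H m : tri_to H (val u) (val w) ->
  phi w (\det H *: m) = phi u m.
Proof.
move=> hH; rewrite phiZ /phi mkgfZ.
have hF := tri_to_frob hH.
rewrite -(mkgf_raise (u := den_pow u char_gt0) (w := den_pow w char_gt0) tU _ hF).
by rewrite (det_map_mx (pFrobenius_aut charRp)).
Qed.

Let phi_kill (w : U) (j : 'I_n) m : (j < n.-1)%N ->
  phi w (val w 0 j *: m) = 0.
Proof.
move=> jn; rewrite phiZ /phi mkgfZ.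
have -> : val w 0 j ^+ p = val (den_pow w char_gt0) 0 j by rewrite mxE.
exact: mkgf_kill.
Qed.

Let h : N -> N := gf_lift (tU := tU) phi.

Let hE m u : h (m // u) = phi u m.
Proof. exact: gf_liftE phiD phi_raise phi_kill _ _. Qed.

Let hD : {morph h : x y / x + y}.
Proof. exact: (gf_liftD phiD phi_raise phi_kill). Qed.

Let hZ a z : h (a *: z) = a ^+ p *: h z.
Proof. by elim/mkgf_ind: z => m u; rewrite mkgfZ !hE phiZ. Qed.

Let ikappa : {linear frob p N -> N} := frob_lift hD hZ.

Let ikappa_over u z :
  ikappa (frob_map p (over u) z) = inu z // den_pow u char_gt0.
Proof.
elim/frob_ind: z => [|r m z IH].
  rewrite !linear0; have -> : inu 0 = 0.
    by apply: (can_inj nuK); rewrite inuK linear0.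
  by rewrite -gf_overE linear0.
rewrite [frob_map p _ _]linearD [ikappa _]linearD IH frob_mapE frob_liftE.
rewrite gf_overE hE /phi mkgfZ -inuZ -tens1 -!gf_overE -linearD.
by rewrite inuD.
Qed.

Lemma kappa_bij_inv : bijective kappa.
Proof.
have diagE (u : U) m :
  (\prod_i val u 0 i ^+ p.-1) *: m // den_pow u char_gt0 = m // u.
  rewrite -det_diag_powv; apply: mkgf_raise.
  by rewrite /= [in powv _ p]char_predn; apply: tri_to_diag.
exists ikappa; first elim/mkgf_ind => m u.
  rewrite -[kappa _]/(kappa_fun _) kappa_funE /kappa_num.
  by rewrite linearZ ikappa_over nuK [LHS]mkgfZ diagE.
pose kk : {linear frob p N -> frob p N} := mklinear (linearP (kappa \o ikappa)).
suff e : kk =1 idfun by exact: e.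
apply: frob_linear_ext; elim/mkgf_ind => m u.
rewrite -[LHS]/(kappa_fun (ikappa (tens 1 (m // u)))) frob_liftE scale1r hE.
rewrite kappa_funE /kappa_num inuK frob_mapE gf_overE tensZ mulr1.
rewrite -[RHS]/(tens 1 (m // u)) -[in RHS]diagE -mkgfZ tens_mid mul1r.
congr (tens _ _); rewrite -prodrXl; apply: eq_bigr => i _.
by rewrite mxE exprAC.
Qed.
End Inverse.

Lemma kappa_bij : bijective kappa.
Proof. by case: (fm_bij M) => inu nuK inuK; apply: kappa_bij_inv nuK inuK. Qed.

Definition genfrac_fmodule : fmodule R p := FModule kappa_bij.

End GenfracFModule.

(* U_f for f = (f_1, ..., f_n) *)
Definition powers_of (R : comNzRingType) (n : nat) (f : 'rV[R]_n)
  : set 'rV[R]_n :=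
  [set v | exists a : 'I_n -> nat, v = \row_i f 0 i ^+ a i]%classic.

Lemma triangular_powers (R : comNzRingType) (n : nat) (f : 'rV[R]_n) :
  triangular (powers_of f).
Proof.
split.
- by exists (\row_i f 0 i ^+ 0); exists (fun=> 0%N).
- move=> _ b [a ->] _; exists (fun i => a i * b i)%N.
  by apply/rowP => i; rewrite !mxE exprM.
- have raise (a b : 'I_n -> nat) :
    tri_to (diag_mx (\row_i f 0 i ^+ b i)) (\row_i f 0 i ^+ a i)
           (\row_i f 0 i ^+ (a i + b i)).
    split; first exact: diag_mx_is_trig.
    apply/matrixP => i j; rewrite ord1 mul_diag_mx !mxE.
    by rewrite exprD mulrC.
  move=> _ _ [a ->] [b ->].
  exists (\row_i f 0 i ^+ (a i + b i)); do 2 eexists; split.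
  + by exists (fun i => a i + b i)%N.
  + exact: raise.
  + have := raise b a; congr (tri_to _ _ _).
    by apply/rowP => i; rewrite !mxE addnC.
Qed.

(* Main.v *)
Require Import Defs.
From HB Require Import structures.
From mathcomp Require Import all_boot all_algebra.
From mathcomp Require Import boolp classical_sets.
From mathcomp Require Import zify.

Set Implicit Arguments.
Unset Strict Implicit.
Unset Printing Implicit Defensive.

Import GRing.Theory.
Local Open Scope ring_scope.

(* Let beta : L -> F(L) generate M, and put L' = L / (f_1, ..., f_(n-1)) L and
   q = p^i. The determinant in the definition of equality of generalized
   fractions may be taken along diagonal matrices, so that M_f is the limit of
   the modules M / (f_1^q, ..., f_(n-1)^q) M under multiplication by powers of
   f_1 ... f_n. As f_j^q kills F^i(L') for j < n, the map
   (f_1 ... f_n)^(p-1) beta : L' -> F(L') generates M_f, through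
     F^i(L') -> M_f,  [x] |-> x / (f_1^q, ..., f_n^q).
   For injectivity only the fact that (f_1^q, ..., f_(n-1)^q) F^i(L) dies in
   F^i(L') is needed, hence no flatness of Frobenius. *)

(** * Quotient of a module by a submodule *)

Section QuotientBySubmodule.
Variables (R : comNzRingType) (V : lmodType R) (S : V -> Prop).
Hypotheses (S0 : S 0) (SD : forall x y, S x -> S y -> S (x + y)).
Hypothesis SZ : forall a x, S x -> S (a *: x).

Let SN x : S x -> S (- x).
Proof. by rewrite -scaleN1r; apply: SZ. Qed.

Let Seq x y : x = y -> S (x - y).
Proof. by move=> ->; rewrite subrr. Qed.

Definition submod_premodule : premodule R.
Proof.
refine (@Premodule R V (fun x y => S (x - y)) 0 -%R +%R *:%R
  _ _ _ _ _ _ _ _ _ _ _ _ _ _) => [x|x y|x y z|x y|x x' y y'|a x y||||||||].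
- exact: Seq.
- by move=> /SN; rewrite opprB.
- by move=> xy yz; rewrite -(subrKA y); apply: SD.
- by move=> /SN; rewrite opprD.
- by rewrite opprD addrACA; apply: SD.
- by rewrite -scalerBr; apply: SZ.
- by move=> x y z; apply/Seq/addrA.
- by move=> x y; apply/Seq/addrC.
- by move=> x; apply/Seq/add0r.
- by move=> x; apply/Seq/addNr.
- by move=> a b x; apply/Seq/scalerA.
- by move=> x; apply/Seq/scale1r.
- by move=> a x y; apply/Seq/scalerDr.
- by move=> a b x; apply/Seq/scalerDl.
Defined.

Definition submod_quot : lmodType R := pm_quot submod_premodule.

Definition submod_class (x : V) : submod_quot :=
  @pm_class _ submod_premodule x.

Lemma submod_class_linear : linear submod_class.
Proof.
move=> a x y; rewrite /submod_class (@pm_classZ _ submod_premodule).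
by rewrite (@pm_classD _ submod_premodule).
Qed.

Definition submod_proj : {linear V -> submod_quot} :=
  mklinear submod_class_linear.

Lemma submod_proj_surj (y : submod_quot) : exists x, submod_proj x = y.
Proof. by elim/pm_ind: y => x; exists x. Qed.

Lemma submod_proj_eq0 x : S x -> submod_proj x = 0.
Proof.
by move=> Sx; apply/(@pm_classP _ submod_premodule); rewrite /= subr0.
Qed.

Section Lift.
Variables (W : lmodType R) (h : {linear V -> W}).
Hypothesis h0 : forall x, S x -> h x = 0.

Definition submod_lift_fun : submod_quot -> W :=
  @pm_lift _ submod_premodule _ h.

Lemma submod_lift_funE x : submod_lift_fun (submod_class x) = h x.
Proof.
apply: (@pm_liftE _ submod_premodule) => y z /h0.
by rewrite linearB => /eqP; rewrite subr_eq0 => /eqP.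
Qed.

Lemma submod_lift_linear : linear submod_lift_fun.
Proof.
move=> a u v; have [x <-] := submod_proj_surj u.
have [y <-] := submod_proj_surj v.
by rewrite -linearP !submod_lift_funE linearP.
Qed.

Definition submod_lift : {linear submod_quot -> W} :=
  mklinear submod_lift_linear.

Lemma submod_liftE x : submod_lift (submod_proj x) = h x.
Proof. exact: submod_lift_funE. Qed.
End Lift.

End QuotientBySubmodule.

(** * Kernel of the maps into a sequential direct limit *)

Section DirectLimitKernel.
Variables (R : comNzRingType) (X : nat -> lmodType R).
Variable d : forall i, {linear X i -> X i.+1}.

(** A formal sum mixes generators of different indices, so the map from [X i] to [X j] has to be
    total; the default 0 keeps it linear. *)
Definition dl_cast i (x : X i) j : X j :=
  if eqP is ReflectT e then ecast j (X j) (e : i = j) x else 0.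

Lemma dl_castE i (x : X i) : dl_cast x i = x.
Proof. by rewrite /dl_cast; case: eqP => // e; rewrite eq_axiomK. Qed.

Lemma dl_cast_linear i j : linear (fun x : X i => dl_cast x j).
Proof.
move=> a x y; rewrite /dl_cast; case: eqP => [e|_]; first by case: _ / e.
by rewrite scaler0 addr0.
Qed.

(* The image of [x : X i] in [X k], with junk value 0 when k < i. *)
Fixpoint dl_push_fun i (x : X i) k : X k :=
  if k is k'.+1 then
    if i == k'.+1 then dl_cast x k'.+1 else d k' (dl_push_fun x k')
  else dl_cast x 0.

Lemma dl_push_linear i k : linear (fun x : X i => dl_push_fun x k).
Proof.
elim: k => [|k IH] /=; first exact: dl_cast_linear.
move=> a x y; case: eqP => _; first exact: dl_cast_linear.
by rewrite IH linearP.
Qed.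

Definition dl_push i k : {linear X i -> X k} := mklinear (@dl_push_linear i k).

Lemma dl_push_id i (x : X i) : dl_push i i x = x.
Proof. by case: i x => [|i] x; rewrite /= ?eqxx dl_castE. Qed.

Lemma dl_pushS i k (x : X i) : (i <= k)%N ->
  dl_push i k.+1 x = d k (dl_push i k x).
Proof. by move=> ik /=; rewrite ltn_eqF. Qed.

(** Induction along the chain starting at stage [i]; the motive ranges over all stages, which keeps
    index casts out of its applications. *)
Lemma dl_push_ind i (Q : forall k, X k -> Prop) (x : X i) : Q i x ->
  (forall k y, (i <= k)%N -> Q k y -> Q k.+1 (d k y)) ->
  forall k, (i <= k)%N -> Q k (dl_push i k x).
Proof.
move=> Q0 QS; elim=> [|k IH].
  by rewrite leqn0 => /eqP i0; case: _ / i0 Q0; rewrite dl_push_id.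
rewrite leq_eqVlt => /predU1P[<-|ik]; first by rewrite dl_push_id.
by rewrite dl_pushS //; apply/QS/IH.
Qed.

Lemma dl_push_comp i k x : (i < k)%N -> dl_push i.+1 k (d i x) = dl_push i k x.
Proof.
elim: k => // k IH; rewrite ltnS leq_eqVlt => /predU1P[<-|ik].
  by rewrite dl_push_id dl_pushS // dl_push_id.
by rewrite !dl_pushS ?IH // ltnW.
Qed.

Lemma dl_push_push i j k x : (i <= j)%N -> (j <= k)%N ->
  dl_push j k (dl_push i j x) = dl_push i k x.
Proof.
move=> ij; move: k; apply: (@dl_push_ind j (fun k y => y = dl_push i k x)) => //.
by move=> k y jk ->; rewrite dl_pushS // (leq_trans ij).
Qed.

Lemma dl_inj_push i k x : (i <= k)%N ->
  dl_inj d k (dl_push i k x) = dl_inj d i x.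
Proof.
move: k; apply: (@dl_push_ind i (fun k y => dl_inj d k y = dl_inj d i x)) => //.
move=> k y _ <-.
by rewrite dl_inj_step.
Qed.

Let push_gen k (g : dl_gen X) := dl_push (tag g) k (tagged g).

(** A derivation of the congruence uses finitely many relations, each of which holds exactly from
    some stage on; the bound comes by induction on the derivation. *)
Lemma dl_push_eq s t : fsum_eq (dl_rel d) s t ->
  exists K, forall k, (K <= k)%N ->
    \sum_(g <- s) push_gen k g = \sum_(g <- t) push_gen k g.
Proof.
elim=> {s t} [s t h|s|s t _ [K e]|s t u _ [K e] _ [K' e']
  |s s' t t' _ [K e] _ [K' e']|s t].
- case: h => [i x y|i|i x].
  + exists 0%N => k _; rewrite big_seq1 big_cons big_seq1.
    exact: (linearD (dl_push i k)).
  + exists 0%N => k _; rewrite big_seq1 big_nil.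
    exact: (linear0 (dl_push i k)).
  (* At stage [i] itself the image of [d i x] is the junk value 0, so agreement is claimed only from
     [i.+1] on. *)
  + by exists i.+1 => k ik; rewrite !big_seq1; apply/esym/dl_push_comp.
- by exists 0%N.
- by exists K => k /e.
- exists (maxn K K') => k; rewrite geq_max => /andP[/e -> /e' ->] //.
- exists (maxn K K') => k; rewrite geq_max !big_cat => /andP[/e -> /e' ->] //.
- by exists 0%N => k _; rewrite !big_cat /= addrC.
Qed.

Lemma dl_inj_eq0 i (x : X i) : dl_inj d i x = 0 ->
  exists K, forall k, (K <= k)%N -> dl_push i k x = 0.
Proof.
move=> /(@pm_classP _ (fsum_premodule (dl_axioms d)) [:: dl_in x] [::]).
move=> /dl_push_eq[K e]; exists K => k /e.
by rewrite big_seq1 big_nil.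
Qed.

Lemma dirlim_inj (y : dirlim d) : exists i x, y = dl_inj d i x.
Proof.
elim/fsum_ind: y => [|[i x] _ [j [z ->]]].
  by exists 0%N, 0; rewrite linear0.
exists (maxn i j), (dl_push i _ x + dl_push j _ z).
by rewrite linearD !dl_inj_push ?leq_maxl ?leq_maxr.
Qed.

End DirectLimitKernel.

(** * Iterated Frobenius functors and a criterion for generating morphisms *)

Section FrobeniusPowers.
Variables (R : comNzRingType) (p : nat).

Lemma frob_map_surj (M N : lmodType R) (h : {linear M -> N}) :
  (forall y, exists x, h x = y) -> forall y, exists x, frob_map p h x = y.
Proof.
move=> hS; elim/frob_ind => [|r m _ [v <-]]; first by exists 0; rewrite linear0.
have [x <-] := hS m; exists (tens r x + v).
by rewrite linearD frob_mapE.
Qed.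

Lemma frob_annihilator (M : lmodType R) a : (forall m : M, a *: m = 0) ->
  forall z : frob p M, a ^+ p *: z = 0.
Proof.
move=> aM; elim/frob_ind => [|r m z IH]; first by rewrite scaler0.
by rewrite scalerDr IH addr0 tensZ mulrC -tens_mid aM tensr0.
Qed.

Fixpoint frob_iter_lin (M N : lmodType R) (h : {linear M -> N}) i :
    {linear frob_iter p M i -> frob_iter p N i} :=
  if i is i'.+1 then frob_map p (frob_iter_lin h i') else h.

Lemma frob_iter_lin_surj (M N : lmodType R) (h : {linear M -> N}) :
  (forall y, exists x, h x = y) ->
  forall i y, exists x, frob_iter_lin h i x = y.
Proof. by move=> hS; elim=> // i IH; apply: frob_map_surj. Qed.

Lemma frob_iter_annihilator (M : lmodType R) a :
  (forall m : M, a *: m = 0) ->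
  forall i (z : frob_iter p M i), a ^+ (p ^ i) *: z = 0.
Proof.
move=> aM; elim=> [|i IH]; first exact: aM.
by rewrite expnSr exprM; apply: frob_annihilator.
Qed.

(** The functor is semilinear on homomorphisms, F(a h) = a^p F(h), so each application of F raises
    the scalar to the power p. *)
Lemma frob_iter_map_scale (M N : lmodType R) (h : {linear M -> N})
    (beta : {linear M -> frob p M}) (gamma : {linear N -> frob p N}) a :
  (forall x, gamma (h x) = a *: frob_map p h (beta x)) ->
  forall i x, frob_iter_map gamma i (frob_iter_lin h i x) =
    a ^+ (p ^ i) *: frob_iter_lin h i.+1 (frob_iter_map beta i x).
Proof.
move=> e; elim=> [|i IH] x; first by rewrite expn0 expr1; apply: e.
pose l : {linear frob_iter p M i -> frob_iter p N i.+1} :=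
  mklinear (linearP (frob_iter_map gamma i \o frob_iter_lin h i)).
pose r : {linear frob_iter p M i -> frob_iter p N i.+1} :=
  mklinear (linearP (frob_iter_lin h i.+1 \o frob_iter_map beta i)).
have lr m : l m = r (a ^+ (p ^ i) *: m).
  by rewrite [r _]linearZ; apply: IH.
rewrite expnSr exprM -[RHS]/(_ *: frob_map p (frob_iter_lin h i.+1)
  (frob_map p (frob_iter_map beta i) x)).
rewrite -[LHS]/(frob_map p (frob_iter_map gamma i)
  (frob_map p (frob_iter_lin h i) x)).
rewrite -(frob_map_comp (h'' := l)) // -(frob_map_comp (h'' := r)) //.
exact: frob_map_scale.
Qed.

(** The extension is forced: [th i.+1] is F([th i]) followed by the inverse of the structure
    isomorphism. Compatibility with the maps of the chain follows by induction, applying F to the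
    previous case. *)
Lemma gen_ext (L : lmodType R) (beta : {linear L -> frob p L})
    (N : fmodule R p) (theta : {linear L -> N}) :
  (forall x, fm_str N (theta x) = frob_map p theta (beta x)) ->
  exists2 th : forall i, {linear frob_iter p L i -> N},
    th 0%N = theta &
    (forall i x, th i.+1 (frob_iter_map beta i x) = th i x) /\
    (forall i y, fm_str N (th i.+1 y) = frob_map p (th i) y).
Proof.
move=> e; have [inu nuK inuK] := fm_bij N.
have inuP : linear inu.
  by move=> a x y; apply: (can_inj nuK); rewrite linearP /= !inuK.
pose nu' : {linear frob p N -> N} := mklinear inuP.
pose th := fix th i : {linear frob_iter p L i -> N} :=
  if i is i'.+1 then mklinear (linearP (nu' \o frob_map p (th i'))) else theta.
have thS i y : fm_str N (th i.+1 y) = frob_map p (th i) y by exact: inuK.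
exists th => //; split=> //; elim=> [|i IH] x; apply: (can_inj nuK).
  by rewrite thS e.
rewrite !thS; symmetry; apply: frob_map_comp => y.
by rewrite IH.
Qed.

(** Compatible maps glue to a map on the limit; every element of the limit comes from some stage, so
    bijectivity can be tested on the stages. *)
Lemma generating_morphismP (L : lmodType R) (beta : {linear L -> frob p L})
    (N : fmodule R p) (th : forall i, {linear frob_iter p L i -> N}) :
  (forall i x, th i.+1 (frob_iter_map beta i x) = th i x) ->
  (forall i y, fm_str N (th i.+1 y) = frob_map p (th i) y) ->
  (forall y, exists i x, th i x = y) ->
  (forall i x, th i x = 0 ->
    exists2 k, (i <= k)%N & dl_push (frob_iter_map beta) i k x = 0) ->
  generating_morphism beta N.
Proof.
move=> thS th_str th_surj th_inj; exists (dl_lift thS).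
  have injl : injective (dl_lift thS).
    move=> u v /eqP; rewrite -subr_eq0 -linearB => /eqP e.
    apply/eqP; rewrite -subr_eq0; apply/eqP; move: (u - v) e => w.
    have [i [x ->]] := dirlim_inj w; rewrite dl_liftE => /th_inj[k ik e].
    by rewrite -(dl_inj_push _ _ ik) e linear0.
  have /choice[g gK] : forall y, exists z, dl_lift thS z = y.
    by move=> y; have [i [x <-]] := th_surj y; exists (dl_inj _ i x);
       rewrite dl_liftE.
  by exists g => // x; apply: injl; rewrite gK.
move=> w; have [i [x ->]] := dirlim_inj w; rewrite dl_liftE.
rewrite -[RHS]/(frob_map p (dl_lift thS) (gen_str beta (dl_inj _ i x))) gen_strE.
rewrite -thS th_str; apply: frob_map_comp => y.
by rewrite dl_liftE.
Qed.

(** Composing the isomorphism with the maps from the stages into the limit allows later arguments to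
    work in the modules F^i(L) only. *)
Lemma generating_morphism_maps (L : lmodType R) (beta : {linear L -> frob p L})
    (N : fmodule R p) : generating_morphism beta N ->
  exists th : forall i, {linear frob_iter p L i -> N},
  [/\ forall i y, fm_str N (th i.+1 y) = frob_map p (th i) y,
    forall i k x, (i <= k)%N ->
      th k (dl_push (frob_iter_map beta) i k x) = th i x,
    forall y, exists i x, th i x = y &
    forall i x, th i x = 0 -> exists K, forall k, (K <= k)%N ->
      dl_push (frob_iter_map beta) i k x = 0].
Proof.
move=> [phi [phi' phiK phi'K] phi_str].
exists (fun i => mklinear (linearP (phi \o dl_inj (frob_iter_map beta) i))).
split=> [i y|i k x ik|y|i x].
- rewrite [LHS]phi_str -[fm_str _ _]/(gen_str beta _) gen_strS.
  by symmetry; apply: frob_map_comp.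
- exact: (congr1 phi (dl_inj_push _ _ ik)).
- by have [i [x e]] := dirlim_inj (phi' y); exists i, x;
  rewrite -[LHS]/(phi (dl_inj _ i x)) -e phi'K.
- move=> e; apply: dl_inj_eq0; apply: (can_inj phiK).
  by rewrite linear0.
Qed.

End FrobeniusPowers.

(** * Fractions whose denominators are powers of a fixed sequence *)

Section PowersOfSequence.
Variables (R : comNzRingType) (n : nat) (f : 'rV[R]_n).

Local Notation fprod := (\prod_(i < n) f 0 i).
Local Notation tU := (triangular_powers f).

Lemma powers_of_powv b : powers_of f (powv f b).
Proof. by exists (fun=> b). Qed.

Definition powers_den b : powers_of f := den (powers_of_powv b).

Lemma powers_of_le v : powers_of f v -> exists B, forall b, (B <= b)%N ->
  exists A, tri_to A v (powv f b).
Proof.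
(* The sum of the exponents bounds each of them. *)
move=> [a ->]; exists (\sum_i a i)%N => b Bb.
exists (diag_mx (\row_i f 0 i ^+ (b - a i))); split.
  exact: diag_mx_is_trig.
apply/matrixP => i j; rewrite ord1 mul_diag_mx !mxE -exprD subnK //.
by apply: leq_trans Bb; rewrite (bigD1 i) //= leq_addr.
Qed.

Lemma tri_to_powers a b : (a <= b)%N ->
  tri_to (diag_mx (powv f (b - a))) (powv f a) (powv f b).
Proof.
move=> ab; split; first exact: diag_mx_is_trig.
by apply/matrixP => i j; rewrite ord1 mul_diag_mx !mxE -exprD subnK.
Qed.

Lemma det_powers b : \det (diag_mx (powv f b)) = fprod ^+ b.
Proof. by rewrite det_diag -prodrXl; apply: eq_bigr => i _; rewrite mxE. Qed.

Lemma in_span_raise (M : lmodType R) a b (m : M) : (a <= b)%N ->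
  in_span (powv f a) n.-1 m -> in_span (powv f b) n.-1 (fprod ^+ (b - a) *: m).
Proof.
move=> ab; rewrite -det_powers.
exact: tri_det_span (tri_to_powers ab) (leq_pred n).
Qed.

Variable M : lmodType R.
Local Notation "m // u" := (mkgf tU m u) (at level 40).

Lemma mkgf_powers_raise a b (m : M) : (a <= b)%N ->
  (fprod ^+ (b - a) *: m) // powers_den b = m // powers_den a.
Proof.
move=> ab; rewrite -det_powers; apply: mkgf_raise.
exact: tri_to_powers.
Qed.

Lemma mkgf_powers_den (y : genfrac M tU) : exists B, forall b, (B <= b)%N ->
  exists m, y = m // powers_den b.
Proof.
elim/mkgf_ind: y => m u; have [B hB] := powers_of_le (denP u).
exists B => b /hB[A hA]; exists (\det A *: m).
by rewrite (mkgf_raise (w := powers_den b) _ _ hA).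
Qed.

(* Any two triangular matrices relating the same denominators have determinants
   that agree up to [tri_det_uniq], so that the matrix witnessing [m / u = 0]
   may be replaced by a diagonal one. *)
Lemma mkgf_powers_eq0 a (m : M) : m // powers_den a = 0 ->
  exists B, forall b, (B <= b)%N ->
    in_span (powv f b) n.-1 (fprod ^+ (b - a) *: m).
Proof.
rewrite -(linear0 (gf_over M tU (powers_den a))) => /mkgfP.
move=> /(gf_same_null tU); rewrite subr0 => -[C [z [Uz hC sC]]].
have [B0 hB0] := powers_of_le Uz; pose c := maxn a B0.
have ac : (a <= c)%N := leq_maxl _ _.
have [A hA] := hB0 c (leq_maxr _ _).
have sq : powv (powv f c) 2 = powv f (c * 2).
  by apply/rowP => i; rewrite !mxE exprM.
(* [A *m C] and a diagonal matrix both carry f^a to f^c; [tri_det_uniq] compares their determinants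
   at the squared denominator, whence the exponent 2c. *)
have s1 := tri_det_uniq m (tri_to_comp hC hA) (tri_to_powers ac).
have s2 := tri_det_span (tri_to_comp hA (tri_to_diag1 _)) (leq_pred n) sC.
rewrite sq in s1 s2; exists (c * 2)%N => b cb.
(* The exponent splits as b - a = (b - 2c) + c + (c - a). *)
have -> : fprod ^+ (b - a) = fprod ^+ (b - c * 2) *
    (\det (diag_mx (powv f c) *m diag_mx (powv f (c - a)))).
  by rewrite det_mulmx !det_powers -!exprD; congr (_ ^+ _); lia.
rewrite -scalerA; apply: in_span_raise cb _.
rewrite -[_ *: m](subKr (\det (diag_mx (powv f c) *m (A *m C)) *: m)).
apply: in_spanD; last exact: in_spanN.
by rewrite mulmxA det_mulmx -scalerA.
Qed.

End PowersOfSequence.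

(** * The candidate generating morphism and its comparison with the fractions *)

Section GeneratingMorphism.
Variables (R : comNzRingType) (p : nat) (charRp : p \in [pchar R]).
Variables (M : fmodule R p) (n : nat) (f : 'rV[R]_n).
Variables (L : lmodType R) (beta : {linear L -> frob p L}).

Local Notation fprod := (\prod_(i < n) f 0 i).
Local Notation tU := (triangular_powers f).
Local Notation N := (genfrac_fmodule charRp M tU).
Local Notation "m // u" := (mkgf tU m u) (at level 40).

Let p_gt1 : (1 < p)%N.
Proof. exact/prime_gt1/(pcharf_prime charRp). Qed.

Definition genfrac_gen : lmodType R :=
  submod_quot (in_span0 L f n.-1) (@in_spanD _ _ L f n.-1)
    (fun a x => @in_spanZ _ _ L a f n.-1 x).

Definition genfrac_proj : {linear L -> genfrac_gen} := submod_proj _ _ _.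

Lemma genfrac_proj_surj y : exists x, genfrac_proj x = y.
Proof. exact: submod_proj_surj. Qed.

Lemma genfrac_gen_annihilator (j : 'I_n) (m : genfrac_gen) : (j < n.-1)%N ->
  f 0 j *: m = 0.
Proof.
move=> jn; have [x <-] := genfrac_proj_surj m.
by rewrite -linearZ; apply/submod_proj_eq0/in_span_gen.
Qed.

Lemma frob_iter_proj_eq0 i x : in_span (powv f (p ^ i)) n.-1 x ->
  frob_iter_lin p genfrac_proj i x = 0.
Proof.
move=> [g ->]; rewrite linear_sum big1 // => j jn.
rewrite linearZ mxE; apply: frob_iter_annihilator => m.
exact: genfrac_gen_annihilator.
Qed.

Let gen_fun : {linear L -> frob p genfrac_gen} :=
  mklinear (linearP (fprod ^+ p.-1 \*: (frob_map p genfrac_proj \o beta))).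

(** Linearity brings out a factor f_j, which together with f_j^(p-1) from [fprod ^+ p.-1] makes
    f_j^p, and this kills F(L'). *)
Let gen_fun0 x : in_span f n.-1 x -> gen_fun x = 0.
Proof.
move=> [g ->]; rewrite linear_sum big1 // => j jn.
rewrite -[LHS]/(fprod ^+ p.-1 *: frob_map p genfrac_proj (beta (f 0 j *: g j))).
rewrite [beta _]linearZ [frob_map _ _ _]linearZ scalerA.
rewrite (bigD1 j) //= exprMn mulrAC -exprSr prednK 1?ltnW // mulrC -scalerA.
rewrite frob_annihilator ?scaler0 // => m.
exact: genfrac_gen_annihilator.
Qed.

(* (f_1 ... f_n)^(p-1) beta, on L / (f_1, ..., f_(n-1)) L *)
Definition genfrac_gen_map : {linear genfrac_gen -> frob p genfrac_gen} :=
  submod_lift _ _ _ gen_fun0.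

Lemma genfrac_gen_mapE x : genfrac_gen_map (genfrac_proj x) =
  fprod ^+ p.-1 *: frob_map p genfrac_proj (beta x).
Proof. exact: submod_liftE. Qed.

Local Notation proj := (frob_iter_lin p genfrac_proj).
Local Notation push := (dl_push (frob_iter_map beta)).
Local Notation push' := (dl_push (frob_iter_map genfrac_gen_map)).

(** The step from stage [k] to [k.+1] contributes the exponent (p - 1) p^k = p^(k+1) - p^k, and the
    sum from [i] on telescopes. *)
Lemma genfrac_gen_push i k x : (i <= k)%N ->
  push' i k (proj i x) = fprod ^+ (p ^ k - p ^ i) *: proj k (push i k x).
Proof.
move: k; apply: (@dl_push_ind _ _ _ i (fun k y =>
  push' i k (proj i x) = fprod ^+ (p ^ k - p ^ i) *: proj k y)).
  by rewrite dl_push_id subnn expr0 scale1r.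
move=> k y ik IH; rewrite dl_pushS // IH linearZ_LR.
rewrite (frob_iter_map_scale genfrac_gen_mapE).
rewrite scalerA -exprM -exprD; congr (_ ^+ _ *: _).
rewrite addnC addnBA ?leq_exp2l // addnC -mulSn prednK 1?ltnW //.
by rewrite -expnS.
Qed.

Section Comparison.
Variable th : forall i, {linear frob_iter p L i -> M}.
Hypothesis th_str : forall i y, fm_str M (th i.+1 y) = frob_map p (th i) y.
Hypothesis th_push : forall i k x, (i <= k)%N -> th k (push i k x) = th i x.
Hypothesis th_surj : forall y, exists i x, th i x = y.
Hypothesis th_inj : forall i x, th i x = 0 ->
  exists K, forall k, (K <= k)%N -> push i k x = 0.

Local Notation over i := (gf_over M tU (powers_den f (p ^ i))).

Lemma kappa_powers k m : kappa charRp M tU (m // powers_den f k) =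
  fprod ^+ (k * p.-1) *: frob_map p (gf_over M tU (powers_den f k)) (fm_str M m).
Proof.
rewrite -[LHS]/(kappa_fun (m // _)) kappa_funE // /kappa_num -prodrXl.
by congr (_ *: _); apply: eq_bigr => j _; rewrite mxE -exprM.
Qed.

(** The factor in [kappa] and the change of denominator from f^(p^i) to f^(p^(i+1)), raised to the
    power p by F, give the same exponent p^(i+1) (p - 1) of f_1 ... f_n. *)
Lemma kappa_over i y : kappa charRp M tU (th i.+1 y // powers_den f (p ^ i.+1)) =
  frob_map p (over i) (frob_map p (th i) y).
Proof.
have pi : (p ^ i <= p ^ i.+1)%N by rewrite leq_exp2l.
rewrite kappa_powers th_str.
rewrite [RHS](frob_over_raise tU (u := powers_den f (p ^ i))
  (w := powers_den f (p ^ i.+1)) _ (tri_to_powers f pi)).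
rewrite det_powers -exprM; congr (_ ^+ _ *: _).
by rewrite mulnBl -subn1 mulnBr muln1 -!expnSr.
Qed.

Let theta0 : {linear L -> N} :=
  mklinear (linearP (gf_over M tU (powers_den f 1) \o th 0)).

Let theta0_eq0 x : in_span f n.-1 x -> theta0 x = 0.
Proof.
move=> [g ->]; rewrite linear_sum big1 // => j jn.
rewrite linearZ -[theta0 _]/(th 0 (g j) // powers_den f 1).
rewrite -[LHS]/(f 0 j *: (th 0 (g j) // powers_den f 1)) mkgfZ.
have {1}-> : f 0 j = val (powers_den f 1) 0 j by rewrite mxE.
exact: mkgf_kill.
Qed.

Let theta : {linear genfrac_gen -> N} := submod_lift _ _ _ theta0_eq0.

Let thetaE x : theta (genfrac_proj x) = th 0 x // powers_den f 1.
Proof. exact: submod_liftE. Qed.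

Let theta_str x :
  fm_str N (theta x) = frob_map p theta (genfrac_gen_map x).
Proof.
have [z <-] := genfrac_proj_surj x.
rewrite thetaE genfrac_gen_mapE.
rewrite -[LHS]/(kappa charRp M tU _) kappa_powers mul1n.
rewrite linearZ; congr (_ *: _).
(* [th_str] speaks of stages above 0, so [z] is first moved to stage 1, where it becomes
   [beta z]. *)
rewrite -(@th_push 0 1 z (leq0n 1)) dl_pushS // (@dl_push_id _ _ _ 0) th_str.
pose l : {linear L -> N} := theta0.
rewrite -(frob_map_comp (h'' := l)) // -(frob_map_comp (h'' := l)) //.
Qed.

Lemma genfrac_generating : generating_morphism genfrac_gen_map N.
Proof.
have [th' th'0 [th'S th'_str]] := gen_ext theta_str.
(* Both sides satisfy the same recursion through the structure isomorphism, which is injective. *)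
have th'E i x : th' i (proj i x) = th i x // powers_den f (p ^ i).
  elim: i x => [|i IH] x; first by rewrite th'0 thetaE.
  apply: (bij_inj (fm_bij N)); rewrite th'_str.
  rewrite -[RHS]/(kappa charRp M tU _) kappa_over.
  pose l : {linear frob_iter p L i -> N} :=
    mklinear (linearP (over i \o th i)).
  rewrite -(frob_map_comp (h'' := l)) // -(frob_map_comp (h'' := l)) //.
apply: (generating_morphismP th'S th'_str) => [y|i x'].
  have [B hB] := mkgf_powers_den y.
  (* Surjectivity: the exponent p^B is large enough because B < p^B, and being a power of p it can
     be matched with a stage. *)
  have [m ->] := hB _ (ltnW (ltn_expl B p_gt1)).
  have [i [x <-]] := th_surj m; pose k := maxn i B.
  have Bk : (p ^ B <= p ^ k)%N by rewrite leq_exp2l // leq_maxr.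
  (* Raising the denominator from exponent p^B to p^k multiplies the numerator by this power of f_1
     ... f_n. *)
  exists k, (proj k (fprod ^+ (p ^ k - p ^ B) *: push i k x)).
  rewrite th'E [th k _]linearZ -(mkgf_powers_raise _ _ Bk).
  by rewrite [th k _]th_push // leq_maxl.
(* Injectivity: the vanishing fraction yields a relation in [M], to be lifted to some F^k(L). *)
have [x <-] := frob_iter_lin_surj genfrac_proj_surj x'; rewrite th'E => /mkgf_powers_eq0[B hB].
pose j := maxn i B.
have ij : (p ^ i <= p ^ j)%N by rewrite leq_exp2l // leq_maxl.
have [|g eg] := hB (p ^ j)%N.
  by apply: leq_trans (ltnW (ltn_expl B p_gt1)) _; rewrite leq_exp2l // leq_maxr.
have /choice[K hK] : forall l : 'I_n, exists K, forall k, (K <= k)%N ->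
    exists y, th k y = g l.
  move=> l; have [q [y <-]] := th_surj (g l); exists q => k qk.
  by exists (push q k y); rewrite th_push.
pose k0 := (j + \sum_l K l)%N.
have /choice[y hy] l : exists y, th k0 y = g l.
  by apply: hK; rewrite /k0 (bigD1 l) //= addnCA leq_addr.
have ik0 : (i <= k0)%N by rewrite (leq_trans (leq_maxl i B)) ?leq_addr.
(* All coefficients lift to stage [k0]. There [d] lifts the relation, so it maps to 0 in [M] and
   dies at some later stage, where the relation holds in F^k(L) itself. *)
pose d := fprod ^+ (p ^ j - p ^ i) *: push i k0 x -
  \sum_(l < n | (l < n.-1)%N) powv f (p ^ j) 0 l *: y l.
have /th_inj[K' hK'] : th k0 d = 0.
  rewrite linearB linear_sum [th k0 (_ *: _)]linearZ /= th_push // eg.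
  apply/eqP; rewrite subr_eq0; apply/eqP/eq_bigr => l _.
  by rewrite [RHS]linearZ hy.
pose k := maxn k0 K'.
have k0k : (k0 <= k)%N := leq_maxl _ _.
have jk : (p ^ j <= p ^ k)%N by rewrite leq_exp2l // (leq_trans _ k0k) ?leq_addr.
exists k; first exact: leq_trans ik0 k0k.
rewrite genfrac_gen_push ?(leq_trans ik0 k0k) // -linearZ.
apply: frob_iter_proj_eq0.
(* The exponent p^j - p^i puts the element into the span of the f_l^(p^j); the remaining factor
   raises that span to exponent p^k. *)
have -> : (p ^ k - p ^ i = (p ^ k - p ^ j) + (p ^ j - p ^ i))%N by lia.
rewrite exprD -scalerA; apply: in_span_raise => //.
have := hK' k (leq_maxr _ _); rewrite linearB linearZ_LR dl_push_push //.
move/eqP; rewrite subr_eq0 => /eqP ->; exists (fun l => push k0 k (y l)).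
by rewrite linear_sum; apply: eq_bigr => l _; rewrite linearZ_LR.
Qed.

End Comparison.

End GeneratingMorphism.

Theorem corollary4p6 (R : comNzRingType) (p : nat) (charRp : p \in [pchar R])
  (regR : regular_ring R) (M : fmodule R p) (finM : F_finite M)
  (n : nat) (n_gt0 : (0 < n)%N) (f : 'rV[R]_n) :
  F_finite (genfrac_fmodule charRp M (triangular_powers f)).
Proof.
have [L [beta [[k [g gL]] /generating_morphism_maps]]] := finM.
move=> [th [th_str th_push th_surj th_inj]].
exists (genfrac_gen f L), (genfrac_gen_map charRp f beta); split.
  exists k, (fun i => genfrac_proj f L (g i)) => y.
  have [x <-] := genfrac_proj_surj y; have [c ->] := gL x.
  by exists c; rewrite linear_sum; apply: eq_bigr => i _; rewrite linearZ.
exact: genfrac_generating th_str th_push th_surj th_inj.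
Qed.
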